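(* Let $a$ and $b$ be positive integers such that $a\not\equiv 0 \pmod 4$, $b$ is squarefree, and $\mathcal{D}$ is squarefree, where $\mathcal{D}=a^2+4b$ if $a$ is odd and $\mathcal{D}=(a/2)^2+b$ if $a$ is even. Let $f(x)=x^2-ax-b\in\mathbb{Z}[x]$. Let $s\ge 1$ be an integer such that $\gcd(b,s)=1$, $\delta_p\ne 1$ for each prime divisor $p\ge 3$ of $s$, and $\delta_3=-1$ if $3\mid s$, where $\delta_p=\left(\frac{\mathcal{D}}{p}\right)$ is the Legendre symbol. For any integer $n\ge 1$, define $\mathcal{F}_n(x)=f(x^{s^n})=x^{2s^n}-ax^{s^n}-b$. Then $\mathcal{F}_n(x)$ is monogenic if and only if no prime divisor of $s$ is an $(a,b)$-Wall-Sun-Sun prime.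
   Context: Let $[U_n]$ be the Lucas sequence defined by $U_0=0$, $U_1=1$, $U_n=aU_{n-1}+bU_{n-2}$ for $n\ge 2$. For an integer $m\ge 2$ with $\gcd(b,m)=1$, the sequence $[U_n]$ is periodic modulo $m$, and $\pi(m)$ denotes the length of its period modulo $m$. An $(a,b)$-Wall-Sun-Sun prime is a prime $p$ with $\gcd(b,p)=1$ such that $\pi(p^2)=\pi(p)$. A monic polynomial $g(x)\in\mathbb{Z}[x]$ of degree $N$ is monogenic if it is irreducible over $\mathbb{Q}$ and $\{1,\theta,\ldots,\theta^{N-1}\}$ is a basis for the ring of integers of $\mathbb{Q}(\theta)$, where $g(\theta)=0$. *)

(* Defs.v *)
From HB Require Import structures.
From mathcomp Require Import all_boot all_order all_algebra all_field.
From mathcomp Require Import boolp classical_sets.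

Set Implicit Arguments.
Unset Strict Implicit.
Unset Printing Implicit Defensive.

Import GRing.Theory.

Fixpoint lucasU (a b n : nat) : nat :=
  match n with
  | 0 => 0
  | 1 => 1
  | (n''.+1 as n').+1 => a * lucasU a b n' + b * lucasU a b n''
  end.

Definition is_lucas_period (a b m t : nat) : Prop :=
  0 < t /\ forall n, lucasU a b (n + t) = lucasU a b n %[mod m].

Definition is_least_lucas_period (a b m t : nat) : Prop :=
  is_lucas_period a b m t /\ forall t', is_lucas_period a b m t' -> t <= t'.

(* Junk value 0 when the sequence is not purely periodic modulo m; this does not
   happen when b is coprime to m > 1, see [lucas_piP]. *)
Definition lucas_pi (a b m : nat) : nat :=
  xget 0 [set t | is_least_lucas_period a b m t].

Definition wall_sun_sun_prime (a b p : nat) : Prop :=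
  [/\ prime p, coprime b p & lucas_pi a b (p ^ 2) = lucas_pi a b p].

Definition squarefree (n : nat) : Prop := forall d, d ^ 2 %| n -> d = 1.

(* Only meaningful for an odd prime p. *)
Definition legendre (D p : nat) : int :=
  if p %| D then 0%R
  else if [exists x : 'I_p, x ^ 2 == D %[mod p]] then 1%R else (-1)%R.

Definition calD (a b : nat) : nat :=
  if odd a then a ^ 2 + 4 * b else (a %/ 2) ^ 2 + b.

Local Open Scope ring_scope.

Definition quadf (a b : nat) : {poly int} :=
  'X^2 - (a%:Z)%:P * 'X - (b%:Z)%:P.

Definition calF (a b s n : nat) : {poly int} := quadf a b \Po 'X^(s ^ n)%N.

Definition ring_of_integers (L : fieldExtType rat) (E : {vspace L}) (x : L) :
  Prop := x \in E /\ integralOver (intr : int -> L) x.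

Definition is_Zbasis (V : zmodType) (O : V -> Prop) (N : nat) (e : 'I_N -> V) :
  Prop :=
  [/\ forall i, O (e i),
      forall c : 'I_N -> int, \sum_i e i *~ c i = 0 -> forall i, c i = 0
    & forall x, O x -> exists c : 'I_N -> int, x = \sum_i e i *~ c i].

(* The field Q(theta) is <<1; theta>>. The last clause ranges over every root of g
   in every number field; for irreducible g such a root exists, see
   [irredp_FAdjoin], and the clause does not depend on which one is taken. *)
Definition monogenic (g : {poly int}) : Prop :=
  [/\ g \is monic,
      irreducible_poly (map_poly intr g : {poly rat})
    & forall (L : fieldExtType rat) (theta : L),
        root (map_poly intr g) theta ->
        is_Zbasis (ring_of_integers <<1; theta>>)
                  (fun i : 'I_(size g).-1 => theta ^+ i)].

Local Close Scope ring_scope.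

Lemma lucasUSS a b n :
  lucasU a b n.+2 = a * lucasU a b n.+1 + b * lucasU a b n.
Proof. by []. Qed.

Lemma lucas_modS a b m i j :
  lucasU a b i = lucasU a b j %[mod m] ->
  lucasU a b i.+1 = lucasU a b j.+1 %[mod m] ->
  lucasU a b i.+2 = lucasU a b j.+2 %[mod m].
Proof.
move=> e0 e1; rewrite !lucasUSS -modnDm -[in RHS]modnDm.
by rewrite -modnMmr e1 modnMmr -(modnMmr b) e0 modnMmr.
Qed.

Lemma lucas_mod_pred a b m i j : coprime b m ->
  lucasU a b i.+1 = lucasU a b j.+1 %[mod m] ->
  lucasU a b i.+2 = lucasU a b j.+2 %[mod m] ->
  lucasU a b i = lucasU a b j %[mod m].
Proof.
wlog le_ij : i j / lucasU a b i <= lucasU a b j.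
  move=> H; case: (leqP (lucasU a b i) (lucasU a b j)) => [|/ltnW] le co e1 e2.
    exact: H.
  by symmetry; apply: H.
rewrite coprime_sym => co e1 e2.
have: a * lucasU a b i.+1 + b * lucasU a b i ==
      a * lucasU a b i.+1 + b * lucasU a b j %[mod m].
  by rewrite -lucasUSS e2 lucasUSS -modnDml -modnMmr -e1 modnMmr modnDml.
rewrite eqn_modDl eq_sym eqn_mod_dvd ?leq_mul2l ?le_ij ?orbT //.
by rewrite -mulnBr Gauss_dvdr // -eqn_mod_dvd // => /eqP->.
Qed.

Lemma lucas_period_exists a b m : 1 < m -> coprime b m ->
  exists t, is_lucas_period a b m t.
Proof.
move=> m_gt1 co; have m_gt0 := ltnW m_gt1.
pose r k : 'I_m := Ordinal (ltn_pmod (lucasU a b k) m_gt0).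
pose h (k : 'I_(m * m).+1) := (r k, r k.+1).
have /injectivePn[i [j ne_ij eq_h]] : ~~ injectiveb h.
  apply/negP=> /injectiveP/leq_card.
  by rewrite card_prod !card_ord ltnn.
wlog lt_ij : i j ne_ij eq_h / i < j.
  move=> H; have [lt|lt|e] := ltngtP i j; first exact: (H i j).
    by apply: (H j i); rewrite // eq_sym.
  by rewrite (val_inj e) eqxx in ne_ij.
have [e0 e1] : lucasU a b i = lucasU a b j %[mod m] /\
               lucasU a b i.+1 = lucasU a b j.+1 %[mod m].
  by case: eq_h => ? ?; split.
exists (j - i); split; first by rewrite subn_gt0.
have down k : k <= i ->
    lucasU a b (i - k) = lucasU a b (j - k) %[mod m] /\
    lucasU a b (i - k).+1 = lucasU a b (j - k).+1 %[mod m].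
  elim: k => [|k IHk] lt_ki; first by rewrite !subn0.
  have [f0 f1] := IHk (ltnW lt_ki).
  have lt_kj := ltn_trans lt_ki lt_ij.
  rewrite (subnSK lt_ki) (subnSK lt_kj); split=> //.
  move: f0 f1; rewrite -(subnSK lt_ki) -(subnSK lt_kj).
  exact: lucas_mod_pred.
have up n : lucasU a b (n + (j - i)) = lucasU a b n %[mod m] /\
            lucasU a b (n + (j - i)).+1 = lucasU a b n.+1 %[mod m].
  elim: n => [|n [f0 f1]]; last by rewrite !addSn; split=> //; apply: lucas_modS.
  by have [f0 f1] := down i (leqnn i); rewrite subnn in f0 f1; split.
by move=> n; case: (up n).
Qed.

Lemma lucas_piP a b m : 1 < m -> coprime b m ->
  is_least_lucas_period a b m (lucas_pi a b m).
Proof.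
move=> m_gt1 co; have [t per_t] := lucas_period_exists a m_gt1 co.
have exP : exists k, `[< is_lucas_period a b m k >] by exists t; apply/asboolP.
apply: (@xgetPex _ 0 [set k | is_least_lucas_period a b m k]%classic).
case: (ex_minnP exP) => k /asboolP per_k min_k.
by exists k; split=> // t' per_t'; apply/min_k/asboolP.
Qed.

(* Main.v *)
From HB Require Import structures.
Require Import Defs.
From mathcomp Require Import all_boot all_order all_algebra all_field.
From mathcomp Require Import all_solvable boolp ring zify.

(** Let F = f(X^N) with N = s^n.  By Dedekind's criterion Z[theta] is integrally
    closed iff F lies in no ideal (p, g)^2 of Z[X] with p prime and g irreducible
    modulo p.  For p prime to N, membership would force p^2 to divide b or the
    discriminant.  For p dividing N put x = X^N, a p-th power: if Q is the order of
    the residue field of (p, g), then x^Q = x modulo (p, g)^2, and since f has at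
    most one root modulo p this gives x^Q = x modulo (p^2, f(x)), i.e. the period
    modulo p^2 divides Q - 1 and p is a Wall-Sun-Sun prime.  The same condition
    yields irreducibility: a factorization of f(X^(p^k)) would have two factors
    sharing their only irreducible factor g modulo p, placing the product in
    (p, g)^2; the degrees 2 p^k then combine to 2 N.  Conversely, if p is a
    Wall-Sun-Sun prime, the common period is prime to p, so x is a p^k-th power
    modulo p^2 and one can write down an integral element outside Z[theta]. *)

Set Implicit Arguments.
Unset Strict Implicit.
Unset Printing Implicit Defensive.

Import GRing.Theory Num.Theory.

Local Open Scope ring_scope.

(** * Congruences modulo an ideal (m, f), with explicit cofactors, and truncated binomial
    expansions *)

Definition cong (R : comNzRingType) (m f x y : R) : Prop :=
  exists A B, x = y + m * A + f * B.

Section Cong.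
Variables (R : comNzRingType) (m f : R).
Implicit Types x y z : R.

Lemma cong_refl x : cong m f x x.
Proof. by exists 0, 0; ring. Qed.

Lemma cong_sym x y : cong m f x y -> cong m f y x.
Proof. by case=> A [B ->]; exists (- A), (- B); ring. Qed.

Lemma cong_trans y x z : cong m f x y -> cong m f y z -> cong m f x z.
Proof. by case=> A [B ->] [A' [B' ->]]; exists (A + A'), (B + B'); ring. Qed.

Lemma congM x y x' y' : cong m f x y -> cong m f x' y' ->
  cong m f (x * x') (y * y').
Proof.
case=> A [B ->] [A' [B' ->]].
exists (A * (y' + m * A' + f * B') + y * A'), (B * (y' + m * A' + f * B') + y * B').
ring.
Qed.

Lemma congX n x y : cong m f x y -> cong m f (x ^+ n) (y ^+ n).
Proof.
move=> xy; elim: n => [|n IHn]; first by rewrite !expr0; apply: cong_refl.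
by rewrite !exprS; apply: congM.
Qed.

Lemma cong_subr0 x y : cong m f (x - y) 0 <-> cong m f x y.
Proof.
split=> [[A [B e]]|[A [B ->]]]; exists A, B; last by ring.
by rewrite -[x](subrK y) e; ring.
Qed.

Lemma cong_dvd n k x y : n = m * k -> cong n f x y -> cong m f x y.
Proof. by move=> -> [A [B ->]]; exists (k * A), B; ring. Qed.
End Cong.

(** Powers of a root of f have Lucas coordinates in the basis 1, x. Keeping the multiple of f(x)
    makes this usable modulo any ideal. *)
Lemma expr_lucas (R : comNzRingType) (a b n : nat) (x : R) :
  exists c, x ^+ n.+1 =
    (lucasU a b n.+1)%:R * x + b%:R * (lucasU a b n)%:R
    + (x ^+ 2 - a%:R * x - b%:R) * c.
Proof.
elim: n => [|n [c IHn]]; first by exists 0; rewrite /= expr1; ring.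
exists (x * c + (lucasU a b n.+1)%:R).
rewrite exprS IHn lucasUSS natrD !natrM; ring.
Qed.

(** The middle binomial coefficients are multiples of p. The linear term in y is kept apart because
    it decides [wall_sun_sun_ramified]. *)
Lemma exprD_prime (R : comNzRingType) (p : nat) (x y : R) : prime p ->
  exists c, (x + y) ^+ p = x ^+ p + p%:R * x ^+ p.-1 * y
                            + p%:R * y ^+ 2 * c + y ^+ p.
Proof.
move=> pp; have p1 := prime_gt1 pp.
case: p p1 pp => [|[|p]] // _ pp.
(* The prime is now [p.+2]; the witness collects the terms in y^2, ..., y^(p+1), with the prime and
   y^2 taken out. *)
exists (\sum_(i < p) x ^+ (p - i.+1 + 1)%N * y ^+ i *+ ('C(p.+2, i.+2) %/ p.+2)).
rewrite exprDn big_ord_recr big_ord_recl big_ord_recl /= subn0 subnn bin0 binn bin1.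
rewrite /bump /= expr0 expr0 expr1 mulr1 mul1r !mulr1n subn1 /= mulr_sumr.
congr (_ + _); rewrite addrA; congr (_ + _ + _); first by rewrite -mulr_natl mulrA.
apply: eq_bigr => i _; rewrite !add1n subSS subSS /= -[in LHS](@divnK p.+2 'C(_, _)).
  rewrite (_ : p - i.+1 + 1 = p - i)%N; last by rewrite addn1 subnSK.
  move: (_ %/ _)%N (x ^+ _) => c X.
  rewrite !exprS expr0 mulr1 mulrnA -[LHS]mulr_natl -[X in _ * X = _]mulr_natl.
  rewrite -[X in _ = _ * X]mulr_natl.
  by move: (y ^+ i) (p.+2%:R : R) (c%:R : R) => Y P C; ring.
by apply: prime_dvd_bin => //=; rewrite !ltnS ltn_ord.
Qed.

(** * Periods of the Lucas sequence *)

Lemma intr_polyC (R : nzRingType) (n : int) : n%:~R = (n%:~R : R)%:P :> {poly R}.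
Proof. by rewrite -(rmorph_int (polyC : R -> {poly R})). Qed.

Lemma natr_polyC (R : nzRingType) (n : nat) : n%:R = (n%:R : R)%:P :> {poly R}.
Proof. by rewrite -(rmorph_nat (polyC : R -> {poly R})). Qed.

Lemma quadfE a b : quadf a b = 'X^2 - a%:R * 'X - b%:R.
Proof. by rewrite /quadf !natr_polyC !natz. Qed.

Lemma size_quadf a b : size (quadf a b) = 3.
Proof.
rewrite /quadf -addrA -opprD size_polyDl ?size_polyXn // size_polyN.
rewrite (leq_ltn_trans (size_polyD _ _)) // gtn_max ltnS.
rewrite (leq_trans (size_polyMleq _ _)) /=; last first.
  by rewrite size_polyX addn2 /= ltnS size_polyC_leq1.
by rewrite (leq_ltn_trans (size_polyC_leq1 _)).
Qed.

Lemma quadf_monic a b : quadf a b \is monic.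
Proof.
rewrite monicE lead_coefE size_quadf /quadf !coefB coefXn coefCM coefX coefC /=.
by rewrite mulr0 !subr0.
Qed.

Lemma quadf_compXE a b N :
  quadf a b \Po 'X^N = 'X^N ^+ 2 - a%:R * 'X^N - b%:R.
Proof.
by rewrite quadfE !comp_polyB !comp_polyM comp_polyX !natr_polyC !comp_polyC.
Qed.

Lemma calD_even a b : ~~ odd a -> (a ^ 2 + 4 * b = 2 ^ 2 * calD a b)%N.
Proof.
move=> ao; rewrite /calD (negbTE ao) mulnDr -expnMn [(2 * _)%N]mulnC divnK //.
by rewrite dvdn2.
Qed.

(** As f is monic of degree 2, the classes of 1 and X form a Z-basis of Z[X]/(f), so the congruence
    can be read off coefficientwise. *)
Lemma cong_quadf_lin a b (m : nat) (u v : int) :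
  cong m%:R (quadf a b) (u%:~R * 'X + v%:~R) 0 -> (m %| u)%Z /\ (m %| v)%Z.
Proof.
set f := quadf a b; case=> A [B]; rewrite add0r => e.
have fm : f \is monic := quadf_monic a b.
have sf : size f = 3 := size_quadf a b.
have f0 : f != 0 by rewrite monic_neq0.
pose A0 := Pdiv.Ring.rmodp A f.
have sA0 : (size A0 < 3)%N by have := Pdiv.Ring.ltn_rmodpN0 A f0; rewrite sf.
have eA : A = Pdiv.Ring.rdivp A f * f + A0 := Pdiv.RingMonic.rdivp_eq fm A.
have e' : u%:~R * 'X + v%:~R - m%:R * A0 = f * (B + m%:R * Pdiv.Ring.rdivp A f).
  by rewrite e {1}eA; ring.
have s' : (size (u%:~R * 'X + v%:~R - m%:R * A0)%R < 3)%N.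
  rewrite (leq_ltn_trans (size_polyD _ _)) // gtn_max size_polyN; apply/andP; split.
    by rewrite !intr_polyC size_MXaddC; case: ifP; rewrite // ltnS;
       rewrite ltnS size_polyC_leq1.
  by rewrite natr_polyC mul_polyC (leq_ltn_trans (size_scale_leq _ _)).
have z : B + m%:R * Pdiv.Ring.rdivp A f = 0.
  apply/eqP; apply: contraLR s' => nz; rewrite -leqNgt e'.
  rewrite size_monicM ?sf //; move: nz; rewrite -size_poly_gt0; by case: (size _) => [|k] // _; rewrite addnS.
move: e'; rewrite z mulr0 => /subr0_eq e'.
have c0 := congr1 (fun q : {poly int} => q`_0) e'.
have c1 := congr1 (fun q : {poly int} => q`_1) e'.
move: c0 c1; rewrite !intr_polyC natr_polyC !coefD !coefCM !coefC !coefX /=.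
rewrite mulr0 add0r mulr1 addr0 !intz !natz => -> ->.
by rewrite !dvdz_mulr.
Qed.

Lemma eqz_modn (m x y : nat) : (m %| x%:Z - y%:Z)%Z <-> x = y %[mod m].
Proof.
split=> [|e]; last first.
  by rewrite -eqz_mod_dvd !modz_nat e.
by rewrite -eqz_mod_dvd !modz_nat => /eqP [].
Qed.

Section Period.
Variables (a b m : nat).
Let f := quadf a b.

(** Two consecutive terms determine all later ones, so a return to 0, 1 suffices. *)
Lemma lucas_periodP t : (0 < t)%N ->
  lucasU a b t = 0 %[mod m] -> lucasU a b t.+1 = 1 %[mod m] ->
  is_lucas_period a b m t.
Proof.
move=> t0 e0 e1; split=> // n.
suff [] : lucasU a b (n + t) = lucasU a b n %[mod m] /\
  lucasU a b (n + t).+1 = lucasU a b n.+1 %[mod m] by [].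
elim: n => [|n [IH0 IH1]]; first by rewrite add0n.
by split; [rewrite addSn | rewrite addSn; apply: lucas_modS].
Qed.

Lemma lucas_period_muln t k i : is_lucas_period a b m t ->
  lucasU a b (i + k * t) = lucasU a b i %[mod m].
Proof.
case=> _ per; elim: k => [|k IHk] in i *; first by rewrite addn0.
by rewrite mulSn addnA IHk per.
Qed.

Lemma lucas_pi_dvd n : (1 < m)%N -> coprime b m -> is_lucas_period a b m n ->
  (lucas_pi a b m %| n)%N.
Proof.
move=> m1 co [n0 pern]; have [pert tmin] := lucas_piP a m1 co.
have [t0 _] := pert; set t := lucas_pi a b m in t0 pert tmin *.
have [//|r0] := posnP (n %% t)%N; first by move/eqP.
have /tmin : is_lucas_period a b m (n %% t).
  split=> // i; rewrite -(lucas_period_muln (n %/ t) _ pert) -addnA [(_ %% _ + _)%N]addnC -divn_eq.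
  exact: pern.
by rewrite leqNgt ltn_mod t0.
Qed.

Lemma cong_lucas (n : nat) : cong m%:R f ('X ^+ n.+1)
  ((lucasU a b n.+1)%:R * 'X + b%:R * (lucasU a b n)%:R).
Proof.
have [c ->] := expr_lucas a b n ('X : {poly int}).
by exists 0, c; rewrite /f quadfE; ring.
Qed.

Lemma lucas_period_lin t : coprime b m -> (0 < t)%N ->
  (m %| (lucasU a b t.+1)%:Z - 1)%Z -> (m %| b%:Z * (lucasU a b t)%:Z)%Z ->
  is_lucas_period a b m t.
Proof.
move=> co t0 h1 h2; apply: lucas_periodP => //; last by apply/eqz_modn.
move: h2; rewrite -PoszM dvdzE /= => h2; apply/eqP.
by rewrite mod0n; rewrite Gauss_dvdr 1?coprime_sym // in h2.
Qed.

(** Translates periods into powers of X in Z[X]/(m, f). There X (X - a) = b is invertible, so X can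
    be cancelled from X^(t+1) = X. *)
Lemma lucas_period_cong t : coprime b m -> (0 < t)%N ->
  cong m%:R f ('X ^+ t) 1 <-> is_lucas_period a b m t.
Proof.
move=> co t0; split=> [h|[_ per]].
  have h1 : cong m%:R f ('X ^+ t.+1) 'X.
    by rewrite exprS -[X in cong _ _ _ X]mulr1; apply: congM h; apply: cong_refl.
  have := cong_trans (cong_sym (cong_lucas t)) h1.
  move/cong_subr0; rewrite (_ : _ - 'X = ((lucasU a b t.+1)%:Z - 1)%:~R * 'X
     + (b%:Z * (lucasU a b t)%:Z)%:~R); last by ring.
  by case/cong_quadf_lin => ? ?; apply: lucas_period_lin.
have dvd1 : exists y : int, (lucasU a b t.+1)%:Z = 1 + m%:Z * y.
  have /eqz_modn/dvdzP[y] := per 1%N.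
  by rewrite add1n /= => e; exists y; rewrite mulrC -e; ring.
have dvd0 : exists y : int, (lucasU a b t)%:Z = m%:Z * y.
  have /eqz_modn/dvdzP[y] := per 0%N.
  by rewrite add0n /= => e; exists y; rewrite mulrC -e; ring.
have {}dvd1 : exists y : {poly int}, (lucasU a b t.+1)%:R = 1 + m%:R * y.
  by case: dvd1 => y e; exists y%:~R; rewrite -[_%:R]/((lucasU a b t.+1)%:Z%:~R) e; ring.
have {}dvd0 : exists y : {poly int}, (lucasU a b t)%:R = m%:R * y.
  by case: dvd0 => y e; exists y%:~R; rewrite -[_%:R]/((lucasU a b t)%:Z%:~R) e; ring.
have h1 : cong m%:R f ('X ^+ t.+1) 'X.
  apply: cong_trans (cong_lucas t) _.
  case: dvd0 => y0 ->; case: dvd1 => y1 ->.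
  by exists (y1 * 'X + b%:R * y0), 0; ring.
(* By Bezout u inverts b modulo m, hence (X - a) u inverts X modulo (m, f). *)
have [u [v buv]] : exists u v : {poly int}, b%:R * u = 1 + m%:R * v.
  have [u [v e]] := Bezoutz b m; exists u%:~R, (- v)%:~R.
  have {}e : u * b%:Z + v * m%:Z = 1 by rewrite e /gcdz /= (eqP co).
  have := congr1 (fun i : int => i%:~R : {poly int}) e.
  rewrite rmorphD !rmorphM /= -[b%:~R]/(b%:R) -[m%:~R]/(m%:R) => e'.
  by move/(canRL (addrK _)): e' => e'; rewrite mulrC e' rmorphN /=; ring.
have /cong_subr0[A [B e]] := h1.
have h2 : cong m%:R f (('X - a%:R) * u * ('X ^+ t.+1 - 'X)) 0.
  by exists (('X - a%:R) * u * A), (('X - a%:R) * u * B); rewrite e; ring.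
apply/cong_subr0; case: h2 => A' [B' e2].
exists (A' - v * ('X ^+ t - 1)), (B' - u * ('X ^+ t - 1)).
rewrite /f quadfE exprS in e2 *.
move: ('X^t) (b%:R : {poly int}) buv e2 => T B0 buv e2.
have {}e2 : ('X - a%:R) * u * ('X * T - 'X) =
  m%:R * A' + ('X^2 - a%:R * 'X - B0) * B' by rewrite e2; ring.
have e3 : T - 1 = (B0 * u - m%:R * v) * (T - 1) by rewrite buv; ring.
have e4 : (B0 * u - m%:R * v) * (T - 1) = ('X - a%:R) * u * ('X * T - 'X)
   - m%:R * v * (T - 1) - ('X^2 - a%:R * 'X - B0) * (u * (T - 1)) by ring.
by rewrite [LHS]e3 e4 e2; ring.
Qed.
End Period.

Lemma exprD_linear (R : comNzRingType) (x y : R) n :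
  exists c, (x + y) ^+ n.+1 = x ^+ n.+1 + n.+1%:R * x ^+ n * y + y ^+ 2 * c.
Proof.
elim: n => [|n [c IHn]]; first by exists 0; rewrite !expr1 expr0; ring.
exists (n.+1%:R * x ^+ n + (x + y) * c).
rewrite exprS IHn !exprS -[n.+2]addn1 natrD.
by move: (x ^+ n) (n.+1%:R : R) => X N; ring.
Qed.

Lemma cong_nat (R : comNzRingType) (m x y : nat) (f : R) : x = y %[mod m] ->
  cong m%:R f x%:R y%:R.
Proof.
move=> /eqz_modn/dvdzP[k e]; exists k%:~R, 0.
have {}e : x%:Z = y%:Z + k * m%:Z by rewrite -e; ring.
rewrite mulr0 addr0 mulrC -[LHS]/(x%:Z%:~R) e rmorphD rmorphM /=.
by [].
Qed.

(** X^t is 1 + p A modulo f, and (1 + p A)^p is 1 modulo p^2. *)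
Lemma lucas_period_lift a b p t : prime p -> coprime b p ->
  is_lucas_period a b p t -> is_lucas_period a b (p ^ 2) (p * t).
Proof.
move=> pp co per; have [t0 _] := per; have p0 := prime_gt0 pp.
apply/lucas_period_cong; rewrite ?coprimeXr ?muln_gt0 ?p0 //.
have [A [B e]] := (lucas_period_cong a co t0).2 per.
apply: (@cong_trans _ _ _ ((1 + p%:R * A) ^+ p)).
  rewrite mulnC exprM; apply: congX; exists 0, B; rewrite e; ring.
have := exprD_linear 1 (p%:R * A) p.-1; rewrite (prednK p0) => -[c ->].
rewrite !expr1n natrX; exists (A + A ^+ 2 * c), 0; ring.
Qed.

(** The period modulo p^2 divides n, which is prime to p, and p times the period modulo p; so it
    divides the latter. *)
Lemma wall_sun_sun_of_period a b p n : prime p -> coprime b p -> coprime p n ->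
  is_lucas_period a b (p ^ 2) n -> wall_sun_sun_prime a b p.
Proof.
move=> pp co cn per; split=> //; have p1 := prime_gt1 pp.
have p21 : (1 < p ^ 2)%N by rewrite (@ltn_exp2r 1 p 2).
have co2 : coprime b (p ^ 2) by rewrite coprimeXr.
have [per1 _] := lucas_piP a p1 co; have [per2 _] := lucas_piP a p21 co2.
have d1 := lucas_pi_dvd p21 co2 (lucas_period_lift pp co per1).
have d2 := lucas_pi_dvd p21 co2 per.
apply/eqP; rewrite eqn_dvd; apply/andP; split.
  rewrite Gauss_dvdr // in d1; apply: coprime_dvdl d2 _.
  by rewrite coprime_sym.
apply: lucas_pi_dvd => //; case: per2 => t0 per2; split=> // i.
by have := congr1 (fun x => x %% p)%N (per2 i); rewrite !modn_dvdm ?dvdn_exp.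
Qed.

(** If p divides the discriminant, then (2 T)^p is an integer modulo (p, f), so the
    period modulo p divides p (p - 1); expanding (2 T)^p = (a + (2 T - a))^p shows
    that p (p - 1) is not a period modulo p^2.  For p = 3 this fails:
    (2 T - a)^3 is only divisible by 3 (2 T - a) and may cancel the linear term. *)
Lemma wall_sun_sun_ramified a b p : prime p -> coprime b p ->
  (p %| a ^ 2 + 4 * b)%N -> ~~ (4 %| a)%N -> p != 3 -> ~ wall_sun_sun_prime a b p.
Proof.
move=> pp co dvdD a4 p3 [_ _ epi]; have p1 := prime_gt1 pp.
have p0 := ltnW p1.
have p21 : (1 < p ^ 2)%N by rewrite (@ltn_exp2r 1 p 2).
have co2 : coprime b (p ^ 2) by rewrite coprimeXr.
(* Equal least periods turn every period modulo p into one modulo p^2. *)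
have lift n : is_lucas_period a b p n -> is_lucas_period a b (p ^ 2) n.
  move=> per; have [n0 _] := per; have d := lucas_pi_dvd p1 co per.
  have [pert _] := lucas_piP a p21 co2; move: d pert; rewrite -epi.
  move=> /dvdnP[k ek] pert; split=> // i; rewrite ek.
  by rewrite lucas_period_muln.
have [p2|pn2] := eqVneq p 2%N.
  (* Here a is even and b odd, so 2 is a period modulo 2; as a period modulo 4 it would force U_2 =
     a = 0. *)
  subst p; have bo : odd b by rewrite -coprimen2.
  have ae : ~~ odd a.
    by move: dvdD; rewrite dvdn2 oddD oddM /= addbF oddX.
  have per2 : is_lucas_period a b 2 2.
    apply: lucas_periodP => //=; rewrite ?muln1 ?muln0 ?addn0.
      by apply/eqP; rewrite mod0n -/(dvdn _ _) dvdn2.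
    by rewrite modn2 oddD oddM (negbTE ae) bo.
  have [_ /(_ 0%N)] := lift _ per2.
  rewrite add0n /= muln1 muln0 addn0 mod0n => /eqP; exact/negP.
have p5 : (5 <= p)%N.
  by move: p p1 pp pn2 p3 {dvdD co epi p0 p21 co2 lift} => [|[|[|[|[|p]]]]].
have pan : ~~ (p %| a)%N.
  apply/negP=> pa; move: dvdD; rewrite dvdn_addr ?dvdn_exp //.
  rewrite (Euclid_dvdM 4) // -[4%N]/(2 ^ 2)%N Euclid_dvdX // dvdn_prime2 //.
  rewrite (negbTE pn2) /=; move: co; rewrite coprime_sym prime_coprime //.
  by move/negbTE ->.
have coa : coprime a p by rewrite coprime_sym prime_coprime.
have co22 : coprime 2 p by rewrite prime_coprime // dvdn_prime2 // eq_sym.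
(* M is the totient of p^2, so 2^M and a^M are 1 modulo p^2. *)
pose M := (p * p.-1)%N.
have M0 : (0 < M)%N by rewrite muln_gt0 p0 -subn1 subn_gt0.
have eulM x : coprime x p -> x ^ M = 1 %[mod p ^ 2].
  move=> cx; rewrite /M mulnC; have := @Euler_exp_totient x (p ^ 2).
  by rewrite totient_pfactor //= expn1 => ->; rewrite ?coprimeXr.
pose f := quadf a b; pose P : {poly int} := 2%:R * 'X - a%:R.
have [D' eD] : exists D', (a ^ 2 + 4 * b = p * D')%N.
  by case/dvdnP: dvdD => k ->; exists k; rewrite mulnC.
have eP : P ^+ 2 = p%:R * D'%:R + 4%:R * f.
  by rewrite -natrM -eD /f quadfE natrD natrX natrM /P; ring.
have [c ec] := @exprD_prime {poly int} p a%:R P pp.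
(* As p >= 5, P^4 splits off P^p. Since P^2 = p D' modulo f, both p P^2 and P^p vanish modulo (p^2,
   f), leaving the linear term in P. *)
have {}ec : (2%:R * 'X) ^+ p = a%:R ^+ p + p%:R * a%:R ^+ p.-1 * P
     + p%:R * P ^+ 2 * c + (P ^+ 2) ^+ 2 * P ^+ (p - 4).
  by rewrite -exprM -exprD subnKC 1?ltnW // -ec /P; congr (_ ^+ _); ring.
rewrite eP in ec; move: (P ^+ (p - 4)) ec => W ec.
have cp2 : cong (p ^ 2)%:R f ((2%:R * 'X) ^+ p) (a%:R ^+ p + p%:R * (a%:R ^+ p.-1 * P)).
  rewrite ec natrX; exists (D'%:R * c + D'%:R ^+ 2 * W).
  exists (4%:R * p%:R * c + (8%:R * p%:R * D'%:R + 16%:R * f) * W); ring.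
have cp1 : cong p%:R f ((2%:R * 'X) ^+ p) (a%:R ^+ p).
  apply: cong_trans (cong_dvd (k := p%:R) _ cp2) _; first by rewrite natrX.
  by exists (a%:R ^+ p.-1 * P), 0; ring.
have e2M : cong (p ^ 2)%:R f (2%:R ^+ M) 1.
  by rewrite -natrX; apply: (@cong_nat _ _ _ 1%N); apply: eulM.
have eaM : cong p%:R f (a%:R ^+ M) 1.
  apply: (@cong_dvd _ _ _ (p ^ 2)%:R p%:R); first by rewrite natrX.
  by rewrite -natrX; apply: (@cong_nat _ _ _ 1%N); apply: eulM.
have perM : is_lucas_period a b p M.
  apply/lucas_period_cong => //.
  have h : cong p%:R f ((2%:R * 'X) ^+ M) (a%:R ^+ M).
    by rewrite /M !exprM; apply: congX.
  apply: cong_trans _ (cong_trans h eaM).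
  rewrite exprMn -[X in cong _ _ X _]mul1r; apply: congM.
    by apply: cong_sym; apply: cong_dvd e2M; rewrite natrX.
  exact: cong_refl.
have /lucas_period_cong perM2 := lift _ perM.
have {perM2} cX := perM2 co2 M0.
have : cong (p ^ 2)%:R f ((2%:R * 'X) ^+ M) 1.
  by rewrite exprMn -[X in cong _ _ _ X]mul1r; apply: congM.
move/cong_sym; rewrite /M exprM => h.
have {h} := cong_trans h (congX p.-1 cp2).
have ep : p.-1 = p.-2.+1 by rewrite [RHS]prednK // -subn1 subn_gt0.
rewrite {2}ep; have [c' ->] := exprD_linear (a%:R ^+ p) (p%:R * (a%:R ^+ p.-1 * P)) p.-2.
(* U is the coefficient of X in the first-order expansion of (a^p + p a^(p-1) P)^(p-1), where P = 2
   X - a. Comparison with 1 gives p^2 | U, although p divides none of 2, p - 1 and a. *)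
move=> h; have {h} := cong_trans h _; pose U := (2 * (p * (p.-1 * (a ^ p) ^ p.-2 * a ^ p.-1)))%N.
move=> /(_ (U%:Z%:~R * 'X + (((a ^ p) ^ p.-1)%:Z - (p * (p.-1 * (a ^ p) ^ p.-2 * a ^ p.-1))%:Z * a%:Z)%:~R)).
rewrite -ep; case.
  exists ((a%:R ^+ p.-1 * P) ^+ 2 * c'), 0; rewrite natrX.
  rewrite -[U%:Z%:~R]/(U%:R) rmorphB rmorphM /= -[((a ^ p) ^ p.-1)%:Z%:~R]/(((a ^ p) ^ p.-1)%:R).
  rewrite -[X in _ = _ + (_ - X * _) + _ + _]/((p * (p.-1 * (a ^ p) ^ p.-2 * a ^ p.-1))%:R).
  rewrite -[a%:~R]/(a%:R) /U !natrM !natrX /P.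
  move: (_ ^+ p.-1) (_ ^+ p.-2) (p.-1%:R) (a%:R ^+ p.-1) => *; ring.
set V : int := _ - _ * a%:Z; move=> A [B e].
have /cong_quadf_lin[+ _] : cong (p ^ 2)%:R f (U%:Z%:~R * 'X + (V - 1)%:~R) 0.
  exists (- A), (- B); rewrite rmorphB /=.
  have -> : V%:~R = 1 - U%:Z%:~R * 'X - (p ^ 2)%:R * A - f * B.
    by rewrite [X in X - _ - _ - _]e; ring.
  by ring.
rewrite dvdzE /= /U mulnCA -mulnn dvdn_pmul2l // !Euclid_dvdM // !Euclid_dvdX //.
rewrite (negbTE pan) dvdn_prime2 // (negbTE pn2) /= !orbF.
by move/(dvdn_leq _); rewrite -subn1 subn_gt0 => /(_ p1); rewrite leqNgt subn1 prednK // leqnn.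
Qed.

(** * Reduction modulo p *)

Section Irreducible.
Variable F : fieldType.
Implicit Types g h : {poly F}.

Lemma irreducible_dvdpM g x y : irreducible_poly g ->
  g %| x * y -> (g %| x) || (g %| y).
Proof.
move=> gi gxy; case: (boolP (g %| x)) => //= ngx.
by rewrite -(@Gauss_dvdpr _ _ x) // irreducible_poly_coprime.
Qed.

Lemma irreducible_dvdp1 g : irreducible_poly g -> ~~ (g %| 1).
Proof. by case=> g1 _; rewrite dvdp1 neq_ltn g1 orbT. Qed.

Lemma irreducible_dvdpX g x n : irreducible_poly g -> g %| x ^+ n -> g %| x.
Proof.
move=> gi; elim: n => [|n IHn]; first by rewrite expr0 (negbTE (irreducible_dvdp1 gi)).
by rewrite exprS => /(irreducible_dvdpM gi)/orP[].
Qed.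

Lemma irreducible_factor (q : {poly F}) : (1 < size q)%N ->
  exists2 g, irreducible_poly g & g %| q.
Proof.
have [n] := ubnP (size q); elim: n q => // n IHn q sq q1.
have [[d [d1 dq dltq]]|nred] := pselect (exists d : {poly F}, [/\ size d != 1, d %| q & ~~ (d %= q)]).
  have q0 : q != 0 by rewrite -size_poly_gt0 ltnW.
  have d0 : d != 0 by apply: contraNneq q0 => d0; rewrite d0 dvd0p in dq.
  have ltd : (size d < size q)%N.
    by rewrite ltn_neqAle dvdp_leq // andbT; apply: contra dltq; rewrite dvdp_size_eqp.
  have [|g gi gd] := IHn d (leq_trans ltd sq).
    by rewrite ltn_neqAle eq_sym d1 size_poly_gt0.
  by exists g => //; apply: dvdp_trans dq.
exists q => //; split=> // d d1 dq; apply/negP => /negP neq.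
by apply: nred; exists d.
Qed.

Lemma irreducible_dvd_root (L : fieldType) (i : {rmorphism F -> L}) g h z :
  irreducible_poly g -> root (map_poly i g) z -> root (map_poly i h) z -> g %| h.
Proof.
move=> gi gz hz; apply: contraT; rewrite -irreducible_poly_coprime // => co.
rewrite -(coprimep_map i) in co.
by have := coprimep_root co gz; rewrite -/(root _ _) rootE (eqP hz) eqxx.
Qed.
End Irreducible.

(** Q is the order of the residue field F_p[X]/(g). Since p divides Q, the period Q - 1 found later
    is prime to p. *)
Lemma irreducible_fermat (p : nat) (g : {poly 'F_p}) : prime p -> irreducible_poly g ->
  exists Q, [/\ (1 < Q)%N, (p %| Q)%N & forall h, g %| h ^+ Q - h].
Proof.
move=> pp gi; have [L dL [z gz _]] := irredp_FAdjoin gi.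
have cF : #|'F_p| = p := card_Fp pp.
have dL0 : (0 < \dim {:L})%N by rewrite adim_gt0.
exists (p ^ \dim {:L})%N; split.
- by rewrite -(prednK dL0) expnS (leq_trans (prime_gt1 pp)) // leq_pmulr // expn_gt0 prime_gt0.
- by rewrite -(prednK dL0) expnS dvdn_mulr.
move=> h; apply: (irreducible_dvd_root (i := in_alg L)) gz _ => //.
rewrite rmorphB rmorphXn rootE !hornerE /=.
have := Fermat's_little_theorem {:L} (map_poly (in_alg L) h).[z].
by rewrite memvf cF => /esym/eqP ->; rewrite subrr.
Qed.

Section Reduction.
Variable p : nat.
Hypothesis pp : prime p.

Definition red : {poly int} -> {poly 'F_p} := map_poly (intr : int -> 'F_p).
HB.instance Definition _ := GRing.RMorphism.on red.

Let p0 : (p%:R : {poly int}) != 0.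
Proof. by rewrite natr_polyC polyC_eq0 pnatr_eq0 -lt0n prime_gt0. Qed.

Lemma intr_Fp_eq0 (c : int) : (c%:~R == 0 :> 'F_p) = (p %| c)%Z.
Proof. by rewrite -(dvdz_pcharf (pchar_Fp pp)). Qed.

Lemma red_p : red p%:R = 0.
Proof. by rewrite rmorph_nat natr_polyC pchar_Fp_0. Qed.

Lemma red_eq0 h : red h = 0 -> exists h', h = p%:R * h'.
Proof.
move=> h0; exists (map_poly (fun c => (c %/ p)%Z) h); apply/polyP => i.
rewrite natr_polyC coefCM coef_map_id0 ?div0z // natz mulrC divzK //.
by rewrite -intr_Fp_eq0 -coef_map -/(red h) h0 coef0.
Qed.

Lemma red_surj (q : {poly 'F_p}) : exists h, red h = q.
Proof.
exists (map_poly (fun c : 'F_p => (c : nat)%:Z) q); apply/polyP => i.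
by rewrite coef_map coef_map_id0 //= -pmulrn natr_Zp.
Qed.

Lemma red_dvd g h : red g %| red h -> exists A B, h = g * A + p%:R * B.
Proof.
case/dvdpP => q; have [A <-] := red_surj q => e; exists A.
have [B eB] : exists B, h - g * A = p%:R * B.
  by apply: red_eq0; rewrite rmorphB rmorphM /= e mulrC subrr.
by exists B; rewrite -eB; ring.
Qed.

Lemma dvd_red g A B : red g %| red (g * A + p%:R * B).
Proof. by rewrite rmorphD !rmorphM /= red_p mul0r addr0 dvdp_mulr. Qed.

(** The square of the ideal (p, g) of Z[X]. *)
Definition insq (g h : {poly int}) : Prop :=
  exists A B C, h = g ^+ 2 * A + p%:R * g * B + p%:R ^+ 2 * C.

Section InSq.
Variable g : {poly int}.
Hypothesis gi : irreducible_poly (red g).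

Lemma insq_eq x y : insq g x -> x = y -> insq g y.
Proof. by move=> + <-. Qed.

Lemma insqN x : insq g x -> insq g (- x).
Proof. by case=> A [B [C ->]]; exists (- A), (- B), (- C); ring. Qed.

Lemma insqD x y : insq g x -> insq g y -> insq g (x + y).
Proof. by case=> A [B [C ->]] [A' [B' [C' ->]]]; exists (A + A'), (B + B'), (C + C'); ring. Qed.

Lemma insqMr x y : insq g x -> insq g (x * y).
Proof. by case=> A [B [C ->]]; exists (A * y), (B * y), (C * y); ring. Qed.

Lemma insq_mul x y : red g %| red x -> red g %| red y -> insq g (x * y).
Proof.
case/red_dvd => A [B ->] /red_dvd[A' [B' ->]].
by exists (A * A'), (A * B' + B * A'), (B * B'); ring.
Qed.

Lemma insq_p x : red g %| red x -> insq g (p%:R * x).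
Proof. by apply: insq_mul; rewrite red_p dvdp0. Qed.

Lemma insq_red x : insq g x -> red g %| red x.
Proof.
case=> A [B [C ->]].
rewrite (_ : _ + _ = g * (g * A + p%:R * B) + p%:R * (p%:R * C)); first exact: dvd_red.
by ring.
Qed.

(** (p, g) is generated by a regular sequence, so p is a nonzero class of
    (p, g) / (p, g)^2. *)
Lemma insq_p_inv x : insq g (p%:R * x) -> red g %| red x.
Proof.
case=> A [B [C e]].
have [A' eA] : exists A', A = p%:R * A'.
  apply: red_eq0; apply/eqP.
  have /eqP := congr1 red e; rewrite !rmorphD !rmorphM /= red_p !mul0r !addr0.
  rewrite eq_sym !mulf_eq0 /= (negbTE (irredp_neq0 gi)) //.
have -> : x = g * (g * A' + B) + p%:R * C.
  by apply: (mulfI p0); rewrite e eA; ring.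
exact: dvd_red.
Qed.

Lemma red_dvd_int (c : int) : red g %| red c%:~R -> (p %| c)%Z.
Proof.
rewrite rmorph_int intr_polyC -intr_Fp_eq0; apply: contraLR => c0.
by rewrite (eqp_dvdr _ (_ : _ %= 1)) ?irreducible_dvdp1 // -size_poly_eq1 size_polyC c0.
Qed.

(** An integer in (p, g) is a multiple of p; [insq_p_inv] cancels this p and leaves another integer
    in (p, g). *)
Lemma insq_int (c : int) : insq g c%:~R -> (p%:Z ^+ 2 %| c)%Z.
Proof.
move=> h; have /dvdzP[c' ec] := red_dvd_int (insq_red h).
move: h; rewrite ec mulrC rmorphM /= => /insq_p_inv/red_dvd_int/dvdzP[k ->].
by rewrite expr2 mulrC -mulrA dvdz_mull.
Qed.

(** By the Leibniz rule a derivation maps the square of an ideal into the ideal. *)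
Lemma insq_deriv h : insq g h -> red g %| red h^`().
Proof.
case=> A [B [C ->]]; rewrite !derivD !derivM natr_polyC !derivC -natr_polyC.
set X := (X in _ %| red X).
have -> : X = g * (2%:R * g^`() * A + g * A^`()) + p%:R * (g^`() * B + g * B^`() + p%:R * C^`()).
  by rewrite /X; ring.
exact: dvd_red.
Qed.
End InSq.
End Reduction.

(** * f(X^N) modulo (p, g)^2 *)

(** For an odd prime p this says that the discriminant is not a nonzero square
    modulo p; unlike the Legendre symbol it is also meaningful at p = 2. *)
Definition one_root (a b p : nat) : Prop := forall r r' : 'F_p,
  r ^+ 2 - a%:R * r - b%:R = 0 -> r' ^+ 2 - a%:R * r' - b%:R = 0 -> r = r'.

Section Local.
Variables (a b p : nat) (g : {poly int}).
Hypothesis pp : prime p.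
Hypothesis gi : irreducible_poly (red p g).

Let insq_natE (c : nat) : insq p g c%:R -> (p ^ 2 %| c)%N.
Proof.
rewrite -[c%:R]/(c%:Z%:~R) => /(insq_int pp gi).
by rewrite dvdzE abszX.
Qed.

Let red_natE (c : nat) : red p g %| red p c%:R -> (p %| c)%N.
Proof. by rewrite -[c%:R]/(c%:Z%:~R) => /(red_dvd_int pp gi). Qed.

Let nsq (c : nat) : squarefree c -> ~ (p ^ 2 %| c)%N.
Proof. by move=> sc /sc p1; move: pp; rewrite p1. Qed.

Let redp (x : {poly int}) : red p g %| red p (p%:R * x).
Proof. by rewrite rmorphM /= red_p // mul0r dvdp0. Qed.

(** Here f'(x) lies in (p, g). For odd p, (2 x - a)^2 - 4 f(x) puts the discriminant in (p, g)^2, so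
    p^2 divides D. *)
Lemma not_insq_disc (x : {poly int}) : a <> 0 %[mod 4] -> squarefree b ->
  squarefree (calD a b) -> red p g %| red p (2%:R * x - a%:R) ->
  ~ insq p g (x ^+ 2 - a%:R * x - b%:R).
Proof.
move=> a4 sb sD dx hF; have hF1 := insq_red pp hF.
have [p2|pn2] := eqVneq p 2%N; last first.
  have h4 : insq p g (a ^ 2 + 4 * b)%:R.
    apply: (insq_eq (insqD (insqMr (- 4%:R) hF) (insq_mul pp dx dx))).
  by rewrite natrD natrM natrX; ring.
  move/insq_natE: h4; have [ao|ao] := boolP (odd a).
    by have := nsq sD; rewrite /calD ao.
  rewrite calD_even // Gauss_dvdr; first exact: nsq.
  by rewrite coprimeXl // coprimeXr // prime_coprime // dvdn_prime2.
have ae : (2 %| a)%N.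
  have : red p g %| red p a%:R.
    have : red p g %| red p (2%:R * x - (2%:R * x - a%:R)).
      by rewrite rmorphB dvdp_sub // -p2; apply: redp.
    by rewrite opprB addrCA subrr addr0.
  by move/red_natE; rewrite p2.
have ao : odd a = false by move: ae; rewrite dvdn2; case: odd.
move: sD; rewrite /calD ao; set u := (a %/ 2)%N; set D := (_ + _)%N => sD.
have ea : a = (u * 2)%N by rewrite /u divnK.
have eF : x ^+ 2 - a%:R * x - b%:R = (x - u%:R) ^+ 2 - D%:R.
  rewrite ea /D natrD natrX natrM; ring.
(* At p = 2, f(x) = (x - u)^2 - D with u = a/2 odd. If D is even, x - u is in (2, g) and D in its
   square; if D is odd, b is even, x is in (2, g) and b in its square. *)
have uo : odd u.
  apply: contraPT a4 => ue; case=> //; apply/eqP; rewrite mod0n ea -/(dvdn _ _).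
  by rewrite -[4%N]/(2 * 2)%N dvdn_pmul2r // dvdn2 ue.
have [Do|De] := boolP (odd D); last first.
  have dD : red p g %| red p D%:R.
    have -> : D%:R = p%:R * (D./2)%:R :> {poly int}.
      by rewrite p2 -natrM mul2n even_halfK.
    exact: redp.
  have dxu : red p g %| red p (x - u%:R).
    rewrite eF in hF1; apply: (irreducible_dvdpX (n := 2)) => //.
    by rewrite -rmorphXn -(subrK D%:R (_ ^+ 2)) rmorphD dvdp_add.
  apply: (nsq sD); apply: insq_natE.
  apply: (insq_eq (insqD (insqN hF) (insq_mul pp dxu dxu))); rewrite eF.
  by ring.
have be : ~~ odd b by move: Do; rewrite /D oddD oddX uo.
have db : red p g %| red p b%:R.
  have -> : b%:R = p%:R * (b./2)%:R :> {poly int} by rewrite p2 -natrM mul2n even_halfK.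
  exact: redp.
have dx0 : red p g %| red p x.
  apply: (irreducible_dvdpX (n := 2)) => //.
  rewrite -rmorphXn (_ : x ^+ 2 = (x ^+ 2 - a%:R * x - b%:R) + p%:R * (u%:R * x) + b%:R); last first.
    by rewrite p2 ea natrM; ring.
  by rewrite rmorphD dvdp_add // rmorphD dvdp_add // redp.
apply: (nsq sb); apply: insq_natE.
apply: (insq_eq (insqD (insqD (insqN hF) (insq_mul pp dx0 dx0)) (insqN (insqMr u%:R (insq_p pp dx0))))).
  by rewrite p2 ea natrM; ring.
Qed.

(** If p does not divide u, then x reduces to a root r = -v/u of f in F_p. The conjugate root a - r
    must equal r, so 2 x - a = 2 (x - r) vanishes. *)
Lemma dvd_linear (x : {poly int}) (u v : int) : one_root a b p ->
  red p g %| red p (x ^+ 2 - a%:R * x - b%:R) ->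
  red p g %| red p (u%:~R * x + v%:~R) ->
  red p g %| red p (2%:R * x - a%:R) \/ ((p %| u)%Z /\ (p %| v)%Z).
Proof.
move=> h1 hF huv; have [pu|pu] := boolP (p %| u)%Z.
  right; split=> //; apply: (red_dvd_int pp gi).
  case/dvdzP: pu huv => k ->.
  rewrite (_ : _ + _ = p%:R * (k%:~R * x) + v%:~R); last by rewrite rmorphM /=; ring.
  by rewrite rmorphD /= dvdp_addr.
left; have u0 : u%:~R != 0 :> 'F_p by rewrite intr_Fp_eq0.
pose r : 'F_p := - (v%:~R / u%:~R).
have hr : red p g %| red p x - r%:P.
  rewrite -(@dvdpZr _ u%:~R) // (_ : _ *: _ = red p (u%:~R * x + v%:~R)) //.
  rewrite scalerBr -mul_polyC -mul_polyC -polyCM /r mulrN mulrCA divff // mulr1.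
  by rewrite polyCN opprK rmorphD rmorphM /= !rmorph_int !intr_polyC.
have fr : r ^+ 2 - a%:R * r - b%:R = 0.
  have : red p g %| (r ^+ 2 - a%:R * r - b%:R)%:P.
    have e : red p (x ^+ 2 - a%:R * x - b%:R) =
      (red p x - r%:P) * (red p x + r%:P - a%:R) + (r ^+ 2 - a%:R * r - b%:R)%:P.
      by rewrite !rmorphB !rmorphM /= !rmorph_nat; ring.
    by move: hF; rewrite e dvdp_addr // dvdp_mulr.
  case: gi => g1 _ /dvdp_leq; rewrite polyC_eq0 size_polyC; case: eqP => //= _.
  by move/(_ isT); rewrite leqNgt g1.
have far : (a%:R - r) ^+ 2 - a%:R * (a%:R - r) - b%:R = 0 by rewrite -fr; ring.
have era := h1 _ _ fr far.
have -> : red p (2%:R * x - a%:R) = 2%:R * (red p x - r%:P).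
  rewrite rmorphB rmorphM /= !rmorph_nat mulrBr; congr (_ - _).
  have {}era : a%:R = 2%:R * r by rewrite -[LHS](subrK r) -era; ring.
  by rewrite natr_polyC era polyCM natr_polyC.
exact: dvdp_mull.
Qed.

Lemma not_insq_quadf (N : nat) : a <> 0 %[mod 4] -> squarefree b ->
  squarefree (calD a b) -> (0 < N)%N ->
  ((p %| N)%N -> [/\ coprime b p, one_root a b p & ~ wall_sun_sun_prime a b p]) ->
  ~ insq p g (quadf a b \Po 'X^N).
Proof.
move=> a4 sb sD N0 hp hF; have nd := @not_insq_disc 'X^N a4 sb sD.
rewrite quadf_compXE in hF; have hF1 := insq_red pp hF.
have [pN|pN] := boolP (p %| N)%N; last first.
  (* The derivative N X^(N-1) (2 X^N - a) lies in (p, g), and [nd] excludes its last factor. *)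
  have := insq_deriv pp hF.
  have -> : ('X^N ^+ 2 - a%:R * 'X^N - b%:R : {poly int})^`()
            = N%:R * ('X^(N.-1) * (2%:R * 'X^N - a%:R)).
    rewrite !derivB !derivM !derivXn -[b%:R]mulr1n -[a%:R]mulr1n.
    rewrite !natr_polyC !derivC -!natr_polyC -mulr_natl.
    ring.
  rewrite rmorphM => /(irreducible_dvdpM gi)/orP[/red_natE|]; first exact/negP.
  rewrite rmorphM => /(irreducible_dvdpM gi)/orP[|/nd //].
  (* For N = 1 the factor X^(N-1) is a unit; for N >= 2, X in (p, g) puts X^N, and with F also b, in
     (p, g)^2. *)
  case: N N0 hF {hp hF1 nd pN} => // [] [|N] _ hF.
    by rewrite expr0 rmorph1 (negbTE (irreducible_dvdp1 gi)).
  rewrite rmorphXn => /(irreducible_dvdpX gi) dX.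
  apply: (nsq sb); apply: insq_natE.
  apply: (insq_eq (insqD (insqN hF) (insqMr ('X^(N.+2) * 'X^N - a%:R * 'X^N) (insq_mul pp dX dX)))).
  by rewrite !exprS; ring.
(* Here x = c^p with c^Q = c modulo (p, g), hence x^Q = x modulo (p, g)^2, and
   this makes Q - 1 a period of the Lucas sequence modulo p^2. *)
case: (hp pN) => co h1 nwss; case/dvdnP: pN => N' eN.
pose c : {poly int} := 'X^N'; have ec : 'X^N = c ^+ p by rewrite /c -exprM eN.
rewrite ec in hF hF1 nd; set x := c ^+ p in hF hF1 nd.
have [Q [Q1 pQ hQ]] := irreducible_fermat pp gi.
pose e := c ^+ Q - c.
have he : red p g %| red p e by rewrite rmorphB rmorphXn hQ.
have p1 := prime_gt1 pp.
have xQ : insq p g (x ^+ Q - x).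
  rewrite /x exprAC (_ : c ^+ Q = c + e); last by rewrite /e addrC subrK.
  have [d ->] := exprD_prime c e pp.
  have -> : e ^+ p = e ^+ 2 * e ^+ (p - 2) by rewrite -exprD subnKC.
  apply: (insq_eq (insqD (insqMr (c ^+ p.-1) (insq_p pp he))
                (insqMr (p%:R * d + e ^+ (p - 2)) (insq_mul pp he he)))).
  by ring.
have [t eQ] : exists t, Q = t.+1 by exists Q.-1; rewrite prednK // ltnW.
have [d ed] := expr_lucas a b t x.
pose u := (lucasU a b t.+1)%:Z - 1; pose v := b%:Z * (lucasU a b t)%:Z.
have hl : insq p g (u%:~R * x + v%:~R).
  apply: (insq_eq (insqD xQ (insqMr (- d) hF))); rewrite eQ ed.
  by rewrite /u /v; ring.
(* One use of [dvd_linear] takes a factor p out of both coefficients; after [insq_p_inv] cancels it,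
   a second use gives divisibility by p^2. *)
case: (dvd_linear h1 hF1 (insq_red pp hl)) => [/nd //|[/dvdzP[u' eu] /dvdzP[v' ev]]].
have hl' : insq p g (p%:R * (u'%:~R * x + v'%:~R)).
  by apply: (insq_eq hl); rewrite eu ev !rmorphM /=; ring.
case: (dvd_linear h1 hF1 (insq_p_inv pp gi hl')) => [/nd //|[pu pv]].
have t0 : (0 < t)%N by rewrite -ltnS -eQ.
apply: nwss; apply: (@wall_sun_sun_of_period _ _ _ t) => //.
  rewrite prime_coprime //; apply: contraL pQ => pt.
  by rewrite eQ -addn1 dvdn_addr // dvdn1 neq_ltn p1 orbT.
have pE : (p ^ 2)%:Z = p%:Z * p%:Z by rewrite -mulnn.
apply: lucas_period_lin; rewrite ?coprimeXr // -/u -/v.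
- by rewrite eu pE dvdz_mul.
- by rewrite ev pE dvdz_mul.
Qed.
End Local.

(** * Dedekind's criterion *)

Section NumberField.
Variables (L : fieldExtType rat) (theta : L).

Definition ev : {poly int} -> L := horner_eval theta \o map_poly (intr : int -> L).
HB.instance Definition _ := GRing.RMorphism.on ev.

Lemma evE h : ev h = (map_poly intr h).[theta]. Proof. by []. Qed.

Lemma evX : ev 'X = theta.
Proof. by rewrite evE map_polyX hornerX. Qed.

Lemma map_poly_in_alg_intr (h : {poly int}) :
  map_poly (in_alg L) (map_poly intr h) = map_poly intr h.
Proof. by rewrite -map_poly_comp; apply: eq_map_poly => c /=; rewrite scaler_int. Qed.

Lemma fieldExt_natr_neq0 (n : nat) : (0 < n)%N -> n%:R != 0 :> L.
Proof.
by move=> n0; rewrite -(rmorph_nat (in_alg L)) fmorph_eq0 pnatr_eq0 -lt0n.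
Qed.

(** Multiply a monic equation of y = x / q by a power of q. *)
Lemma integral_ev_quot (q x : {poly int}) y : integralOver (intr : int -> L) y ->
  ev q * y = ev x -> exists r S, ev (x ^+ r) = ev (q * S).
Proof.
case=> P mP; rewrite rootE => /eqP Py e; pose r := (size P).-1.
have sP : size P = r.+1 by rewrite prednK // size_poly_gt0 monic_neq0.
exists r, (- \sum_(i < r) (P`_i)%:~R * q ^+ (r - i.+1) * x ^+ i).
have := congr1 (fun t => ev q ^+ r * t) Py; rewrite mulr0.
rewrite (@horner_coef_wide _ r.+1) ?size_map_poly_id0 ?sP //; last first.
  by rewrite (monicP mP) oner_eq0.
rewrite big_ord_recr /= coef_map -/r (_ : P`_r = 1); last by rewrite -(monicP mP).
rewrite mul1r mulrDr -exprMn e => /eqP; rewrite addrC addr_eq0 => /eqP er.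
rewrite rmorphXn er mulrN rmorphN; congr (- _).
rewrite mulr_sumr rmorphM rmorph_sum /= mulr_sumr; apply: eq_bigr => i _.
rewrite !rmorphM !rmorphXn /= rmorph_int coef_map /= -e exprMn.
rewrite (_ : ev q ^+ r = ev q * ev q ^+ (r - i.+1) * ev q ^+ i); last first.
  by rewrite -exprS -exprD -subSn ?ltn_ord // subSS subnK // ltnW.
by move: (ev q ^+ _) (ev q ^+ _) (y ^+ i) => *; ring.
Qed.

Variable F : {poly int}.
Hypothesis Fm : F \is monic.
Hypothesis Fi : irreducible_poly (map_poly intr F : {poly rat}).
Hypothesis Froot : root (map_poly intr F) theta.

Lemma ev_root : ev F = 0.
Proof. exact/eqP. Qed.

Lemma ev_eq0_small (r : {poly int}) : (size r < size F)%N -> ev r = 0 -> r = 0.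
Proof.
move=> sr er; apply/eqP; apply: contraLR sr => r0; rewrite -leqNgt.
have : map_poly intr F %| (map_poly intr r : {poly rat}).
  apply: (irreducible_dvd_root (i := in_alg L)) (theta) _ _ _ => //; rewrite map_poly_in_alg_intr //.
  exact/eqP.
move/dvdp_leq; rewrite !size_map_inj_poly //; try exact: intr_inj.
by apply; rewrite map_poly_eq0_id0 // intr_eq0 lead_coef_eq0.
Qed.

Lemma ev_modp h : ev h = ev (Pdiv.Ring.rmodp h F).
Proof.
by rewrite [in LHS](Pdiv.RingMonic.rdivp_eq Fm h) rmorphD rmorphM /= ev_root mulr0 add0r.
Qed.

Lemma ltn_modp h : (size (Pdiv.Ring.rmodp h F) < size F)%N.
Proof. by rewrite Pdiv.Ring.ltn_rmodpN0 // monic_neq0. Qed.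

Lemma ev_eq0 h : ev h = 0 -> exists K, h = F * K.
Proof.
move=> eh; exists (Pdiv.Ring.rdivp h F).
rewrite {1}(Pdiv.RingMonic.rdivp_eq Fm h) (ev_eq0_small (ltn_modp h)) ?addr0 1?mulrC //.
by rewrite -ev_modp.
Qed.

Lemma ev_eq h k : ev h = ev k -> exists K, h = k + F * K.
Proof.
move=> e; have [K eK] : exists K, h - k = F * K.
  by apply: ev_eq0; rewrite rmorphB /= e subrr.
by exists K; rewrite -eK; ring.
Qed.

Lemma integral_ev h : integralOver (intr : int -> L) (ev h).
Proof.
apply: (integral_horner (RtoK := intr)).
  by apply/integral_poly => c; rewrite coef_map; apply: integral_id.
by exists F.
Qed.

(** The elements of Z[theta] whose quotient by p is integral form an ideal.  If it
    were larger than (p), it would contain H(theta) for some H with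
    F = g H + p M, g irreducible modulo p.  Then y = H(theta) / p satisfies
    p y = H(theta) and g(theta) y = - M(theta), which forces g to divide H and M
    modulo p, that is, F in (p, g)^2. *)
Lemma dedekind_saturated p : prime p ->
  (forall g, irreducible_poly (red p g) -> ~ insq p g F) ->
  forall h, integralOver (intr : int -> L) (ev h / p%:R) ->
  exists h', ev h = p%:R * ev h'.
Proof.
move=> pp nsq h hint; have pL : p%:R != 0 :> L by rewrite fieldExt_natr_neq0 // prime_gt0.
have F0 : red p F != 0 by rewrite monic_neq0 // monic_map.
have [/(red_dvd pp)[A [B ->]]|ndvd] := boolP (red p F %| red p h).
  by exists B; rewrite rmorphD !rmorphM /= ev_root mul0r add0r rmorph_nat.
(* Modulo p, the cofactor e of the gcd d in F is not constant. With g an irreducible factor of e and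
   w = e / g, a lift H of w d satisfies F = g H modulo p. *)
pose d := gcdp (red p h) (red p F).
have /dvdpP[e ee] : d %| red p F := dvdp_gcdr _ _.
have e0 : e != 0 by apply: contraNneq F0 => e0; rewrite ee e0 mul0r.
have e1 : (1 < size e)%N.
  rewrite ltn_neqAle eq_sym size_poly_gt0 e0 andbT; apply: contra ndvd => /size_poly1P[c c0 ec].
  by rewrite ee ec mul_polyC dvdpZl // dvdp_gcdl.
have [gb gi gd] := irreducible_factor e1.
have [g eg] := red_surj gb; rewrite -eg {gb eg} in gi gd.
have [w ew] := dvdpP _ _ gd; have [W eW] := red_surj w.
have [u [v euv]] : exists u v, d = u * red p h + v * red p F.
  have [[u v] /=] := Bezoutp (red p h) (red p F).
  rewrite eqp_sym -/d => /eqpfP euv.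
  rewrite euv; move: (_ / _) => c; exists (c *: u), (c *: v).
  by rewrite scalerDr !scalerAl.
have [U eU] := red_surj u; have [V eV] := red_surj v.
(* This lift is a combination of h and F, so H(theta) / p stays integral. *)
pose H := W * (U * h + V * F).
have eH : red p H = w * d by rewrite rmorphM rmorphD !rmorphM /= eW eU eV euv.
have [M eM] : exists M, F - g * H = p%:R * M.
  apply: (red_eq0 pp); rewrite rmorphB rmorphM /= eH ee ew; ring.
have gF : red p g %| red p F by rewrite ee dvdp_mulr.
pose y := ev H / p%:R.
have ey : p%:R * y = ev H by rewrite mulrC divfK.
have yint : integralOver (intr : int -> L) y.
  have -> : y = ev W * (ev U * (ev h / p%:R)).
    by rewrite /y /H rmorphM rmorphD !rmorphM /= ev_root mulr0 addr0 !mulrA.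
  apply: (integral_mul (RtoK := intr)); first exact: integral_ev.
  by apply: (integral_mul (RtoK := intr)); first exact: integral_ev.
(* By integrality some power of x is q S modulo F, and g divides both q and F modulo p. *)
have gfac q x : ev q * y = ev x -> red p g %| red p q -> red p g %| red p x.
  move=> eqx gq; have [r [S eS]] := integral_ev_quot yint eqx.
  have [K eK] := ev_eq eS; apply: (irreducible_dvdpX (n := r)) => //.
  by rewrite -rmorphXn eK rmorphD !rmorphM /= dvdp_add // dvdp_mulr.
have gH : red p g %| red p H.
  by apply: (gfac p%:R); rewrite ?red_p ?dvdp0 // rmorph_nat.
have gM : red p g %| red p M.
  have : red p g %| red p (- M).
    apply: (gfac g) => //; apply: (mulfI pL).
    have := congr1 ev eM; rewrite rmorphB (rmorphM ev g H) (rmorphM ev p%:R M) /=.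
    rewrite ev_root rmorph_nat sub0r => eM'.
    by rewrite rmorphN mulrN -eM' opprK -ey; ring.
  by rewrite rmorphN /= dvdpNr.
case: (nsq g gi); apply: (insq_eq (insqD (insq_mul pp (dvdpp _) gH) (insq_p pp gM))).
by rewrite -eM; ring.
Qed.

(** Write x as h(theta) / n; [dedekind_saturated] removes the prime divisors of n one at a time. *)
Lemma ring_of_integers_ev :
  (forall p g, prime p -> irreducible_poly (red p g) -> ~ insq p g F) ->
  forall x, ring_of_integers <<1; theta>>%VS x -> exists h, x = ev h.
Proof.
move=> nsq x [xin xint].
have clear n : forall h, (0 < n)%N -> n%:R * x = ev h -> exists h', x = ev h'.
  have [k] := ubnP n; elim: k n => // k IHk n nk h n0 eh.
  have [n1|n1] := eqVneq n 1%N; first by exists h; rewrite -eh n1 mul1r.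
  have pp : prime (pdiv n) by rewrite pdiv_prime // ltn_neqAle eq_sym n1.
  move: (pdiv n) pp (pdiv_dvd n) => p pp /dvdnP[m en].
  have p0 := prime_gt0 pp.
  have m0 : (0 < m)%N by move: n0; rewrite en muln_gt0 => /andP[].
  have pL := fieldExt_natr_neq0 p0.
  have ehp : ev h / p%:R = m%:R * x.
    by apply: (mulIf pL); rewrite divfK // -eh en natrM; ring.
  have [|h' eh'] := @dedekind_saturated p pp (nsq p ^~ pp) h.
    by rewrite ehp; apply: (integral_mul (RtoK := intr)) => //; apply: integral_nat.
  apply: (IHk m _ h') => //; last by rewrite -ehp eh' mulrAC divff ?mul1r.
  by rewrite ltnS in nk; rewrite (leq_trans _ nk) // en -[X in (X < _)%N]muln1 ltn_pmul2l // prime_gt1.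
have [q xq] := Fadjoin1_polyP xin.
have [q1 [c c0 eq1]] := rat_poly_scale q.
apply: (clear `|c|%N ((sgz c)%:~R * q1)); first by rewrite absz_gt0.
have ec : c%:~R * x = ev q1.
  rewrite xq eq1 linearZ /= hornerZ map_poly_in_alg_intr evE mulrA.
  rewrite -[c%:~R in LHS]scaler_int -scalerAl mul1r scalerA divff ?intr_eq0 //.
  by rewrite scale1r mul1r.
rewrite rmorphM /= rmorph_int -ec mulrA; congr (_ * _).
by rewrite -intrM -abszEsg.
Qed.

Lemma dedekind_basis :
  (forall p g, prime p -> irreducible_poly (red p g) -> ~ insq p g F) ->
  is_Zbasis (ring_of_integers <<1; theta>>%VS)
            (fun i : 'I_(size F).-1 => theta ^+ i).
Proof.
move=> nsq; have sF : (size F).-1.+1 = size F.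
  by rewrite prednK // size_poly_gt0 monic_neq0.
have evP (c : 'I_(size F).-1 -> int) :
    \sum_(i < (size F).-1) theta ^+ i *~ c i = ev (\sum_(i < (size F).-1) (c i)%:P * 'X^i).
  rewrite rmorph_sum /=; apply: eq_bigr => i _.
  by rewrite rmorphM rmorphXn /= evX evE map_polyC hornerC mulrC -[LHS]mulr1 mulrzAl mulrzr mulr1.
split=> [i|c|x xO].
- split; first by rewrite rpredX // memv_adjoin.
  by rewrite -evX -rmorphXn; apply: integral_ev.
- rewrite evP => /ev_eq0_small e i.
  have : (\sum_(i < (size F).-1) (c i)%:P * 'X^i)`_i = 0.
    rewrite e ?coef0 // -[X in (_ < X)%N]sF ltnS (leq_trans (size_sum _ _ _)) //.
    by apply/bigmax_leqP => j _; rewrite mul_polyC (leq_trans (size_scale_leq _ _)) // size_polyXn.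
  rewrite coef_sum (bigD1 i) //= coefCM coefXn eqxx mulr1 big1 ?addr0 // => j.
  rewrite -val_eqE /= => ij.
  by rewrite coefCM coefXn eq_sym (negbTE ij) mulr0.
have [h ->] := ring_of_integers_ev nsq xO.
exists (fun i => (Pdiv.Ring.rmodp h F)`_i); rewrite evP ev_modp; congr ev.
under eq_bigr do rewrite mul_polyC; rewrite -poly_def; apply/polyP => i.
rewrite coef_poly; case: ltnP => // le; rewrite nth_default //.
by apply: leq_trans le; rewrite -ltnS sF ltn_modp.
Qed.
End NumberField.

(** * Irreducibility *)

(** By Gauss's lemma a factorization descends to Z with unit leading coefficients, so degrees
    persist modulo p. Both factors then share an irreducible g modulo p, and their product lies in
    (p, g)^2. *)
Lemma schonemann p (F : {poly int}) : prime p -> F \is monic -> (1 < size F)%N ->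
  (forall g h, irreducible_poly g -> irreducible_poly h ->
     g %| red p F -> h %| red p F -> g %| h) ->
  (forall g, irreducible_poly (red p g) -> ~ insq p g F) ->
  irreducible_poly (map_poly intr F : {poly rat}).
Proof.
move=> pp Fm F1 uniq nsq; split=> [|d d1 dF]; first by rewrite size_rat_int_poly.
have [A [c c0 ed] [B eF]] := dvdpP_rat_int dF.
have sd : size d = size A by rewrite ed size_scale // size_rat_int_poly.
have F0 := monic_neq0 Fm.
have /andP[A0 B0] : (A != 0) && (B != 0) by rewrite -negb_or -mulf_eq0 -eF.
have lAB : lead_coef A * lead_coef B = 1 by rewrite -lead_coefM -eF (monicP Fm).
have [B1|B1] := eqVneq (size B) 1%N.
  rewrite -dvdp_size_eqp // sd size_rat_int_poly eF size_mul // B1 addn1.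
  by [].
have redsize (C D : {poly int}) : lead_coef C * lead_coef D = 1 -> size (red p C) = size C.
  move=> lCD; rewrite size_map_poly_id0 //; apply/eqP => l0.
  have := congr1 (fun z : int => z%:~R : 'F_p) lCD.
  by rewrite rmorphM /= l0 mul0r => /esym/eqP; rewrite oner_eq0.
have sA := redsize _ _ lAB; have sB : size (red p B) = size B.
  by apply: (redsize _ A); rewrite mulrC.
have eredF : red p F = red p A * red p B by rewrite eF rmorphM.
have [|g gi gA] := @irreducible_factor _ (red p A).
  by rewrite sA ltn_neqAle eq_sym -sd d1 sd size_poly_gt0.
have [|h hi hB] := @irreducible_factor _ (red p B).
  by rewrite sB ltn_neqAle eq_sym B1 size_poly_gt0.
have gh : g %| h by apply: uniq; rewrite // eredF ?(dvdp_mulr _ gA) ?(dvdp_mull _ hB).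
have [G eG] := red_surj g; subst g.
case: (nsq G gi); rewrite eF; apply: insq_mul => //; exact: dvdp_trans hB.
Qed.

Section Quadratic.
Variables (a b : nat).

Lemma ev_quadf_compX (L : fieldExtType rat) (x : L) N :
  ev x (quadf a b \Po 'X^N) = x ^+ N ^+ 2 - a%:R * x ^+ N - b%:R.
Proof.
by rewrite quadf_compXE !rmorphB !rmorphM !rmorph_nat !rmorphXn /= evX.
Qed.

Lemma size_quadf_compX N : (0 < N)%N -> size (quadf a b \Po 'X^N) = (2 * N).+1.
Proof.
move=> N0; have := size_comp_poly (quadf a b) 'X^N.
rewrite size_quadf size_polyXn /= => <-; rewrite prednK // size_poly_gt0.
by rewrite comp_poly_eq0 ?size_polyXn // monic_neq0 // quadf_monic.
Qed.

Lemma quadf_compX_monic N : (0 < N)%N -> quadf a b \Po 'X^N \is monic.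
Proof.
move=> N0; rewrite monicE lead_coef_comp ?size_polyXn // (monicP (quadf_monic a b)).
by rewrite lead_coefXn expr1n mulr1.
Qed.

Variable p : nat.
Hypothesis pp : prime p.

Lemma natrX_pchar (R : comNzRingType) (q n : nat) :
  [pchar R].-nat q -> (n%:R : R) ^+ q = n%:R.
Proof.
move=> hq; have q0 : (0 < q)%N by case/andP: hq.
elim: n => [|n IHn]; first by rewrite expr0n eqn0Ngt q0.
by rewrite -addn1 natrD exprDn_pchar // IHn expr1n.
Qed.

Lemma pchar_polyFp k : [pchar {poly 'F_p}].-nat (p ^ k)%N.
Proof.
by rewrite pnatX pnatE // pchar_poly pchar_Fp.
Qed.

(** Frobenius is additive modulo p and fixes the coefficients of f. *)
Lemma red_quadf_compX m k :
  red p (quadf a b \Po 'X^(m * p ^ k)) = red p (quadf a b \Po 'X^m) ^+ (p ^ k).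
Proof.
have ch := pchar_polyFp k.
have redE i : red p (quadf a b \Po 'X^i) = 'X^i ^+ 2 - a%:R * 'X^i - b%:R.
  rewrite quadf_compXE !rmorphB !rmorphM !rmorph_nat !rmorphXn /=.
  by rewrite [red p 'X]map_polyX.
rewrite !redE exprDn_pchar // exprNn_pchar // exprDn_pchar // exprNn_pchar //.
by rewrite !exprMn !natrX_pchar // (exprM 'X m).
Qed.

(** Two coprime irreducible factors of a quadratic would be linear with distinct roots. *)
Lemma quadf_factor_unique g h : one_root a b p ->
  irreducible_poly g -> irreducible_poly h ->
  g %| red p (quadf a b) -> h %| red p (quadf a b) -> g %| h.
Proof.
move=> h1 gi hi gf hf; case: (boolP (g %| h)) => // ngh.
have co : coprimep g h by rewrite irreducible_poly_coprime.
have fm : red p (quadf a b) \is monic by rewrite monic_map // quadf_monic.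
have sf : size (red p (quadf a b)) = 3.
  by rewrite size_map_poly_id0 ?size_quadf // (monicP (quadf_monic a b)) oner_eq0.
have dgh : g * h %| red p (quadf a b) by rewrite Gauss_dvdp // gf.
have [g1 _] := gi; have [h1' _] := hi.
have /andP[/eqP sg /eqP sh] : (size g == 2) && (size h == 2).
  have := dvdp_leq (monic_neq0 fm) dgh; rewrite sf size_mul ?irredp_neq0 //; lia.
have root_f r : root (red p (quadf a b)) r -> r ^+ 2 - a%:R * r - b%:R = 0.
  rewrite rootE quadfE !rmorphB !rmorphM !rmorph_nat /= [red p 'X]map_polyX.
  by rewrite !natr_polyC !hornerE => /eqP.
have [r rg] := poly2_root sg; have [r' rh] := poly2_root sh.
have er : r = r' by apply: h1; apply: root_f; [exact: root_dvdp gf rg|exact: root_dvdp hf rh].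
subst r'.
have := coprimep_root co rg; by rewrite (eqP rh) eqxx.
Qed.

Hypotheses (a4 : a <> 0 %[mod 4]) (sb : squarefree b) (sD : squarefree (calD a b)).

Lemma quadf_comp_primeX_irreducible k : one_root a b p ->
  ((0 < k)%N -> coprime b p /\ ~ wall_sun_sun_prime a b p) ->
  irreducible_poly (map_poly intr (quadf a b \Po 'X^(p ^ k)) : {poly rat}).
Proof.
move=> h1 hk; have q0 : (0 < p ^ k)%N by rewrite expn_gt0 prime_gt0.
apply: (schonemann pp); rewrite ?quadf_compX_monic ?size_quadf_compX ?ltnS ?muln_gt0 //.
  rewrite -[(p ^ k)%N]mul1n red_quadf_compX // expr1 comp_polyXr => g h gi hi.
  move=> /(irreducible_dvdpX gi) gf /(irreducible_dvdpX hi) hf.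
  exact: quadf_factor_unique.
move=> g gi; apply: not_insq_quadf => // pq.
have k0 : (0 < k)%N by case: k pq {hk q0} => //; rewrite expn0 Euclid_dvd1.
by have [co nw] := hk k0; split.
Qed.
End Quadratic.

Lemma dim_Fadjoin_irreducible (L : fieldExtType rat) (P : {poly rat}) (x : L) :
  irreducible_poly P -> root (map_poly (in_alg L) P) x ->
  \dim <<1; x>> = (size P).-1.
Proof.
move=> Pi Px; rewrite dim_Fadjoin dimv1 muln1.
have /polyOver1P[m em] := minPolyOver 1%AS x.
have Pm : P %| m.
  by apply: (irreducible_dvd_root (i := in_alg L)) Px _ => //; rewrite -em root_minPoly.
have mP : m %| P.
  rewrite -(dvdp_map (in_alg L)) -em; apply: minPoly_dvdp => //.
  by apply/polyOver1P; exists P.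
have : size P = size m by apply: eqp_size; rewrite /eqp Pm mP.
by move=> ->; rewrite -(size_map_poly (in_alg L)) -em size_minPoly.
Qed.

Lemma quadf_compX_irreducible a b N : (0 < a)%N -> (0 < b)%N -> a <> 0 %[mod 4] ->
  squarefree b -> squarefree (calD a b) -> (0 < N)%N ->
  (forall p, prime p -> (p %| N)%N ->
     [/\ coprime b p, one_root a b p & ~ wall_sun_sun_prime a b p]) ->
  irreducible_poly (map_poly intr (quadf a b \Po 'X^N) : {poly rat}).
Proof.
move=> a0 b0 a4 sb sD N0 hN; set F := map_poly _ _.
have sF : size F = (2 * N).+1 by rewrite size_rat_int_poly size_quadf_compX.
have irr2 : irreducible_poly (map_poly intr (quadf a b) : {poly rat}).
  (* Positivity of a and b gives D a prime divisor p. The difference of two roots of f in F_p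
     squares to the discriminant, which is 0 there, so [one_root] holds and k = 0 applies. *)
  have D1 : (1 < calD a b)%N.
    rewrite /calD; case: ifP => ao; first by rewrite (leq_trans _ (leq_addl _ _)) //; lia.
    rewrite -addn1 leq_add // expn_gt0 divn_gt0 //; case: (a) a0 ao => [|[]] //.
  set p := pdiv (calD a b); have pp : prime p := pdiv_prime D1.
  have pD : (p %| a ^ 2 + 4 * b)%N.
    have := pdiv_dvd (calD a b); rewrite -/p.
    have [ao|ao] := boolP (odd a); first by rewrite /calD ao.
    by rewrite calD_even //; apply: dvdn_mull.
  have h1 : one_root a b p.
    move=> r r' fr fr'; have D0 : (a%:R ^+ 2 + 4%:R * b%:R : 'F_p) = 0.
      by rewrite -natrX -natrM -natrD; apply/eqP; rewrite -(dvdn_pcharf (pchar_Fp pp)).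
    have [e|/eqP ne] := eqVneq r r'; first by [].
    have e2 : (r - r') * (r + r' - a%:R) = 0.
      by rewrite -[RHS](subrr 0) -{1}fr -fr'; ring.
    have /eqP/subr0_eq e3 : r + r' - a%:R == 0.
      by move/eqP: e2; rewrite mulf_eq0 subr_eq0 => /orP[/eqP|].
    have : (r - r') ^+ 2 = 0.
      rewrite -[RHS]D0 -e3 (_ : b%:R = r ^+ 2 - a%:R * r); last by apply/esym/subr0_eq.
      by rewrite -e3; ring.
    by move/eqP; rewrite expf_eq0 /= subr_eq0 => /eqP.
  by have := @quadf_comp_primeX_irreducible a b p pp a4 sb sD 0 h1; rewrite expn0 expr1 comp_polyXr; apply.
split=> [|d d1 dF]; first by rewrite sF ltnS muln_gt0.
have F0 : F != 0 by rewrite -size_poly_gt0 sF.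
have d0 : d != 0 by apply: contraNneq F0 => d0; rewrite d0 dvd0p in dF.
have [|G Gi Gd] := @irreducible_factor _ d.
  by rewrite ltn_neqAle eq_sym d1 size_poly_gt0.
have [L dL [theta Gt _]] := irredp_FAdjoin Gi.
have Ft : root (map_poly (in_alg L) F) theta.
  by apply: root_dvdp Gt; rewrite dvdp_map; apply: dvdp_trans dF.
(* theta^m is a root of f(X^q), so Q(theta^m) is a subfield of L of degree 2 q. *)
have dimq q m : N = (q * m)%N ->
    irreducible_poly (map_poly intr (quadf a b \Po 'X^q) : {poly rat}) ->
  (2 * q %| \dim {:L})%N.
  move=> eN qi; have q0 : (0 < q)%N by move: N0; rewrite eN muln_gt0 => /andP[].
  have qt : root (map_poly (in_alg L) (map_poly intr (quadf a b \Po 'X^q))) (theta ^+ m).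
    move: Ft; rewrite /F eN !map_poly_in_alg_intr !rootE -!evE !ev_quadf_compX.
    by rewrite mulnC exprM.
  have := dim_Fadjoin_irreducible qi qt; rewrite size_rat_int_poly size_quadf_compX //= => <-.
  by apply: field_dimS; apply: subvf.
(* It suffices to treat each p-part, which divides twice the p-part of N. When p does not divide N,
   f itself supplies the factor 2. *)
have dvdL : (2 * N %| \dim {:L})%N.
  apply/dvdn_partP; first by rewrite muln_gt0.
  move=> p; rewrite mem_primes => /andP[pp _].
  rewrite partnM //; apply: (@dvdn_trans (2 * N`_p)); first by rewrite dvdn_mul ?dvdn_part.
  have eN : N = (N`_p * N`_p^')%N by rewrite partnC.
  apply: (dimq _ _ eN); rewrite p_part.
  have [pN|pN] := boolP (p %| N)%N.
    by have [co h1 nw] := hN p pp pN; apply: quadf_comp_primeX_irreducible.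
  by rewrite lognE pp (negbTE pN) andbF expn0 expr1 comp_polyXr.
rewrite -dvdp_size_eqp // eqn_leq dvdp_leq //= sF.
apply: leq_trans (dvdp_leq d0 Gd).
have G0 := irredp_neq0 Gi; rewrite -(prednK (_ : 0 < size G)%N) ?size_poly_gt0 // ltnS -dL.
by apply: dvdn_leq; rewrite // adim_gt0.
Qed.

(** * Wall-Sun-Sun primes give non-monogenic polynomials *)

Lemma legendre_square (p D : nat) (y : 'F_p) : prime p -> y != 0 ->
  y ^+ 2 = D%:R -> legendre D p = 1.
Proof.
move=> pp y0 e; have FE (m : nat) : (m%:R == 0 :> 'F_p) = (p %| m)%N.
  by rewrite -(dvdn_pcharf (pchar_Fp pp)).
rewrite /legendre -FE -e expf_eq0 /= (negbTE y0).
case: ifP => // /existsP[]; have yp : (y %% p < p)%N by rewrite ltn_pmod ?prime_gt0.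
exists (Ordinal yp) => /=; apply/eqP; rewrite modnXm; apply/eqz_modn.
by rewrite -(intr_Fp_eq0 pp) rmorphB /= -!pmulrn natrX natr_Zp e subrr.
Qed.

(** The difference of two distinct roots squares to the discriminant, which is D or 4 D, so D would
    be a nonzero square. *)
Lemma one_root_odd a b p : prime p -> p != 2%N -> legendre (calD a b) p <> 1 ->
  one_root a b p.
Proof.
move=> pp p2 hl r r' fr fr'; apply: contra_not_eq hl => ne.
have two0 : 2%:R != 0 :> 'F_p.
  by rewrite -(dvdn_pcharf (pchar_Fp pp)) dvdn_prime2.
have e2 : (r - r') * (r + r' - a%:R) = 0.
  by rewrite -[RHS](subrr 0) -{1}fr -fr'; ring.
have /eqP/subr0_eq e3 : r + r' - a%:R == 0.
  by move/eqP: e2; rewrite mulf_eq0 subr_eq0 (negbTE ne).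
have disc : (r - r') ^+ 2 = (a ^ 2 + 4 * b)%:R.
  rewrite natrD natrM natrX -e3 (_ : b%:R = r ^+ 2 - a%:R * r); last by apply/esym/subr0_eq.
  by rewrite -e3; ring.
have ne' : r - r' != 0 by rewrite subr_eq0.
have [ao|ao] := boolP (odd a).
  by apply: (legendre_square (y := r - r')) => //; rewrite disc /calD ao.
apply: (legendre_square (y := (r - r') / 2%:R)) => //.
  by rewrite mulf_neq0 // invr_neq0.
by rewrite expr_div_n disc calD_even // natrM natrX mulrAC divff ?mul1r // expf_neq0.
Qed.

Lemma one_root_2 a b : odd b -> one_root a b 2.
Proof.
move=> bo; have F2 (r : 'F_2) : r != 0 -> r = 1.
  by move=> r0; apply/eqP; move: r0; case: r => [[|[|]]].
have b1 : b%:R = 1 :> 'F_2.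
  by apply: F2; rewrite -(dvdn_pcharf (pchar_Fp (isT : prime 2))) dvdn2 bo.
suff h (r : 'F_2) : r ^+ 2 - a%:R * r - b%:R = 0 -> r = 1.
  by move=> r r' /h -> /h ->.
move=> e; apply: F2; apply/eqP => r0; move: e; rewrite r0 b1 => /eqP.
by rewrite expr0n /= mulr0 subr0 sub0r oppr_eq0 oner_eq0.
Qed.

(** A root of f modulo p would be double, making p divide the discriminant, against
    [wall_sun_sun_ramified]. So f is irreducible modulo p and the period divides Q - 1, where p
    divides Q. *)
Lemma wall_sun_sun_coprime a b p : prime p -> wall_sun_sun_prime a b p ->
  one_root a b p -> ~~ (4 %| a)%N -> ((p %| a ^ 2 + 4 * b)%N -> p != 3) ->
  coprime p (lucas_pi a b p).
Proof.
move=> pp wss h1 a4 hp3; have [_ co _] := wss; have p1 := prime_gt1 pp.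
have [[r fr]|noroot] := pselect (exists r : 'F_p, r ^+ 2 - a%:R * r - b%:R = 0).
  have fr' : (a%:R - r) ^+ 2 - a%:R * (a%:R - r) - b%:R = 0 by rewrite -fr; ring.
  have er := h1 _ _ fr fr'.
  have pD : (p %| a ^ 2 + 4 * b)%N.
    rewrite (dvdn_pcharf (pchar_Fp pp)) natrD natrM natrX.
    have -> : b%:R = r ^+ 2 - a%:R * r by apply/esym/subr0_eq.
    have -> : a%:R = r + r by rewrite -[LHS](subrK r) -er.
    by apply/eqP; ring.
  by have := wall_sun_sun_ramified pp co pD a4 (hp3 pD).
have sf : size (red p (quadf a b)) = 3.
  by rewrite size_map_poly_id0 ?size_quadf // (monicP (quadf_monic a b)) oner_eq0.
have fi : irreducible_poly (red p (quadf a b)).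
  apply: cubic_irreducible; rewrite ?sf // => r; apply/negP.
  rewrite rootE quadfE !rmorphB !rmorphM !rmorph_nat /= [red p 'X]map_polyX.
  by rewrite !natr_polyC !hornerE => /eqP fr; apply: noroot; exists r.
have [Q [Q1 pQ hQ]] := irreducible_fermat pp fi.
have [t eQ] : exists t, Q = t.+1 by exists Q.-1; rewrite prednK // ltnW.
have t0 : (0 < t)%N by rewrite -ltnS -eQ.
have /(red_dvd pp)[A [B e]] : red p (quadf a b) %| red p ('X^Q - 'X).
  by rewrite [red p ('X^Q - 'X)]rmorphB /= rmorphXn hQ.
have per : is_lucas_period a b p t.
  pose u := (lucasU a b t.+1)%:Z - 1; pose v := b%:Z * (lucasU a b t)%:Z.
  have [C eC] := expr_lucas a b t ('X : {poly int}).
  have [|pu pv] := @cong_quadf_lin a b p u v; last exact: lucas_period_lin.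
  exists B, (A - C); rewrite /u /v mulrBr -quadfE in eC *.
  rewrite addrA add0r [p%:R * B + _]addrC -e eQ eC; ring.
rewrite prime_coprime //; apply: contraL pQ => pt.
have /(dvdn_trans pt) := lucas_pi_dvd p1 co per.
by rewrite eQ -addn1 => h; rewrite dvdn_addr // dvdn1 neq_ltn p1 orbT.
Qed.

(** The error carries the factor x besides p; with x = [Gam] it becomes the middle term of the
    quadratic equation in [integral_Gam]. *)
Lemma exprD_primeX (R : comNzRingType) (p k : nat) (x y : R) : prime p ->
  exists A, (x + y) ^+ (p ^ k) = x ^+ (p ^ k) + y ^+ (p ^ k) + p%:R * x * A.
Proof.
move=> pp; elim: k => [|k [A IHk]]; first by exists 0; rewrite !expr1; ring.
have q0 : (0 < p ^ k)%N by rewrite expn_gt0 prime_gt0.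
rewrite expnSr !exprM IHk; set X := x ^+ (p ^ k); set Y := y ^+ (p ^ k).
have eX : X = x * x ^+ (p ^ k).-1 by rewrite -exprS prednK.
have [c1 ->] := exprD_prime (X + Y) (p%:R * x * A) pp.
(* The roles are exchanged so that the error terms contain X, hence x. *)
have [c2] := exprD_prime Y X pp; rewrite [Y + X]addrC => e2.
have -> : (p%:R * x * A) ^+ p = p%:R * x * A * (p%:R * x * A) ^+ p.-1.
  by rewrite -exprS prednK // prime_gt0.
exists (Y ^+ p.-1 * x ^+ (p ^ k).-1 + X * x ^+ (p ^ k).-1 * c2
  + p%:R * (X + Y) ^+ p.-1 * A + p%:R ^+ 2 * x * A ^+ 2 * c1
  + A * (p%:R * x * A) ^+ p.-1).
have eX2 : X ^+ 2 = x * (X * x ^+ (p ^ k).-1) by rewrite {1 2}eX; ring.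
rewrite e2 eX2 [in p%:R * Y ^+ p.-1 * X]eX.
move: (X ^+ p) (Y ^+ p) ((X + Y) ^+ p.-1) (Y ^+ p.-1) (x ^+ (p ^ k).-1)
  ((p%:R * x * A) ^+ p.-1) => *; ring.
Qed.

Lemma integral_quadratic (R K : comNzRingType) (f : {rmorphism R -> K}) (d u v : K) :
  integralOver f u -> integralOver f v -> d ^+ 2 + u * d + v = 0 -> integralOver f d.
Proof.
move=> fu fv e.
have s2 : (size (u%:P * 'X + v%:P)%R < 3)%N.
  by rewrite size_MXaddC; case: ifP => // _; rewrite !ltnS size_polyC_leq1.
apply: (integral_root_monic (p := 'X^2 + (u%:P * 'X + v%:P))).
- by rewrite monicE lead_coefDl ?size_polyXn // lead_coefXn.
- by rewrite rootE !hornerE; apply/eqP.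
apply/integral_poly => i; rewrite !coefD coefXn coefCM coefX coefC.
case: i => [|[|[|i]]] /=; rewrite ?mulr0 ?mulr1 ?add0r ?addr0 //.
- exact: integral1.
- exact: integral0.
Qed.

(** If g has multiplicity v in y, then n v > n forces v >= 2. *)
Lemma irreducible_dvdp_sqr (F : fieldType) (g y : {poly F}) n :
  irreducible_poly g -> g ^+ n.+1 %| y ^+ n -> g ^+ 2 %| y.
Proof.
move=> gi h; have g0 := irredp_neq0 gi.
have /dvdpP[z ez] : g %| y.
  by apply: (irreducible_dvdpX (n := n)) => //; apply: dvdp_trans h; rewrite exprS dvdp_mulr.
move: h; rewrite ez exprMn exprS dvdp_mul2r ?expf_neq0 // => /(irreducible_dvdpX gi) gz.
by rewrite expr2 dvdp_mul2r.
Qed.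

(** With beta = theta^(N e) one has beta^q = theta^N modulo p^2,
    and Gamma = theta^m - beta yields the integral element Gamma^(q-1) / p outside Z[theta]. *)
Section NotMonogenic.
Variables (a b p q m e : nat) (L : fieldExtType rat) (theta : L).
Hypotheses (pp : prime p) (co : coprime b p) (q1 : (1 < q)%N)
  (qp : exists k, q = (p ^ k)%N) (m0 : (0 < m)%N) (pm : ~~ (p %| m)%N).
Let N := (m * q)%N.
Let F := quadf a b \Po 'X^N.
Hypothesis Fi : irreducible_poly (map_poly intr F : {poly rat}).
Hypothesis Froot : root (map_poly intr F) theta.
Hypothesis he : cong (p ^ 2)%:R (quadf a b) ('X ^+ (q * e)) 'X.

Let Gam : {poly int} := 'X^m - 'X^(N * e).

Let N0 : (0 < N)%N.
Proof. by rewrite muln_gt0 m0 ltnW. Qed.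

Let Fm : F \is monic.
Proof. exact: quadf_compX_monic. Qed.

Let pL : p%:R != 0 :> L.
Proof. by rewrite fieldExt_natr_neq0 ?prime_gt0. Qed.

(** By Frobenius theta^N = (Gamma + beta)^q is Gamma^q + beta^q up to p Gamma A; substituting X^N
    into [he] gives beta^q = theta^N modulo p^2. *)
Lemma Gam_power : exists A C : {poly int},
  ev theta (Gam ^+ q) = ev theta (- (p%:R * Gam * A) - p%:R ^+ 2 * C).
Proof.
have [A [B eX]] := he; have [k ek] := qp.
have /(congr1 (fun P => P \Po 'X^N)) := eX.
rewrite !comp_polyD !comp_polyM comp_Xn_poly natr_polyC comp_polyC -natr_polyC comp_polyX.
rewrite -/F natrX => eN.
have [A' eA'] := @exprD_primeX {poly int} p k Gam 'X^(N * e) pp.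
rewrite /Gam subrK -ek -!exprM -/N (_ : N * e * q = N * (q * e))%N in eA'; last lia.
exists A', (A \Po 'X^N).
have -> : Gam ^+ q = 'X^N - 'X^(N * (q * e)) - p%:R * Gam * A'.
  by rewrite eA' /Gam; ring.
rewrite exprM eN !rmorphB /= !rmorphD /= [ev theta (F * _)]rmorphM /= (ev_root Froot).
by rewrite !rmorphN /=; ring.
Qed.

(** Multiplying [Gam_power] by Gamma^(q-2) and dividing by p^2 gives d^2 + A d + C Gamma^(q-2) =
    0. *)
Lemma integral_Gam : integralOver (intr : int -> L) (ev theta (Gam ^+ q.-1) / p%:R).
Proof.
have [A [C e1]] := Gam_power; set d := _ / _.
have iev h : integralOver (intr : int -> L) (ev theta h) := integral_ev Fm Froot h.
apply: (integral_quadratic (f := intr) (iev A) (iev (C * Gam ^+ (q - 2)))).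
have ed : p%:R * d = ev theta (Gam ^+ q.-1) by rewrite mulrC divfK.
have eqq : (q.-1 = (q - 2).+1)%N by lia.
apply: (mulfI (expf_neq0 2 pL)); rewrite mulr0.
have -> : p%:R ^+ 2 * (d ^+ 2 + ev theta A * d + ev theta (C * Gam ^+ (q - 2)))
  = (p%:R * d) ^+ 2 + p%:R * (ev theta A * (p%:R * d)) + p%:R ^+ 2 * ev theta (C * Gam ^+ (q - 2)) by ring.
rewrite ed -(rmorph_nat (ev theta)) -!rmorphXn -!rmorphM -!rmorphD /=.
have -> : Gam ^+ q.-1 ^+ 2 = Gam ^+ (q - 2) * Gam ^+ q by rewrite -exprM -exprD; congr (_ ^+ _); lia.
rewrite -addrA; set Z := (X in _ + X).
have -> : ev theta (Gam ^+ (q - 2) * Gam ^+ q + Z) =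
    ev theta (Gam ^+ (q - 2)) * ev theta (Gam ^+ q) + ev theta Z.
  by rewrite rmorphD rmorphM.
rewrite e1 /Z [(p ^+ 2)%:R]rmorphXn.
rewrite -rmorphM -rmorphD /= eqq (exprS Gam).
by rewrite -(rmorph0 (ev theta)); congr (ev theta _); ring.
Qed.

(** Modulo p, F = W^q with W = f(X^m), so an irreducible factor g of W has g^2 | Gamma and g |
    Gamma' = m X^(m-1). Then g divides X, hence b, which is prime to p. *)
Lemma Gam_not_dvd h K : Gam ^+ q.-1 <> p%:R * h + F * K.
Proof.
move=> eG; have [k ek] := qp.
pose W := quadf a b \Po 'X^m.
have eF : red p F = red p W ^+ q by rewrite /F /N ek red_quadf_compX.
have dF : red p W ^+ q %| red p Gam ^+ q.-1.
  have -> : red p Gam ^+ q.-1 = red p F * red p K.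
    by rewrite -rmorphXn eG rmorphD !rmorphM /= red_p // mul0r add0r.
  by rewrite -eF dvdp_mulr.
have sW : size (red p W) = (2 * m).+1.
  by rewrite size_map_poly_id0 ?size_quadf_compX // (monicP (quadf_compX_monic _ _ _)) ?oner_eq0.
have [|gb gi gW] := @irreducible_factor _ (red p W); first by rewrite sW ltnS muln_gt0.
have [g eg] := red_surj gb; subst gb.
have gG : red p g ^+ 2 %| red p Gam.
  apply: (@irreducible_dvdp_sqr _ _ _ q.-1) => //; rewrite prednK ?(ltnW q1) //.
  by apply: dvdp_trans dF; apply: dvdp_exp2r.
have pN : (p %| N)%N.
  rewrite /N ek dvdn_mull //; case: k ek => [ek|k _]; last by rewrite expnS dvdn_mulr.
  by move: q1; rewrite ek.
have gD : red p g %| red p Gam^`().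
  have [G [B eGB]] : exists A B, Gam = g ^+ 2 * A + p%:R * B.
    by apply: red_dvd => //; rewrite rmorphXn.
  rewrite eGB derivD !derivM natr_polyC derivC -natr_polyC mul0r add0r.
  have -> : (g^`() * g + g * g^`()) * G + g ^+ 2 * G^`() + p%:R * B^`() =
    g * (2%:R * g^`() * G + g * G^`()) + p%:R * B^`() by ring.
  exact: dvd_red.
have gX : red p g %| red p 'X.
  move: gD; rewrite /Gam derivB !derivXn -[_ *+ m]mulr_natl -[_ *+ (N * e)]mulr_natl.
  have [N' eN'] := dvdnP pN.
  have -> : m%:R * 'X^(m.-1) - (N * e)%:R * 'X^((N * e).-1) =
    m%:R * 'X^(m.-1) + p%:R * (- (N' * e)%:R * 'X^((N * e).-1)) :> {poly int}.
    by rewrite {1}eN' !natrM; ring.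
  rewrite rmorphD /= dvdp_addl; last by rewrite rmorphM /= red_p // mul0r dvdp0.
  rewrite rmorphM => /(irreducible_dvdpM gi)/orP[|].
    rewrite -[m%:R]/(m%:Z%:~R) => /(red_dvd_int pp gi) pm'; by case/negP: pm.
  by rewrite rmorphXn => /(irreducible_dvdpX gi).
have gXm : red p g %| red p 'X^m.
  by rewrite -(prednK m0) exprS rmorphM dvdp_mulr.
have : red p g %| red p (b%:Z)%:~R.
  have -> : (b%:Z)%:~R = 'X^m * ('X^m - a%:R) - W :> {poly int}.
    by rewrite /W quadf_compXE -[LHS]/(b%:R); ring.
  by rewrite rmorphB /= dvdp_sub // rmorphM dvdp_mulr.
move/(red_dvd_int pp gi) => pb.
by move: co; rewrite coprime_sym prime_coprime // => /negP; apply.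
Qed.

Lemma not_basis :
  ~ is_Zbasis (ring_of_integers <<1; theta>>%VS)
              (fun i : 'I_(size F).-1 => theta ^+ i).
Proof.
case=> _ _ span; have [|c ec] := span (ev theta (Gam ^+ q.-1) / p%:R).
  split; last exact: integral_Gam.
  rewrite rpred_div //; last by rewrite rpred_nat.
  apply/Fadjoin1_polyP; exists (map_poly intr (Gam ^+ q.-1)).
  by rewrite map_poly_in_alg_intr.
pose h := \sum_(i < (size F).-1) (c i)%:P * 'X^i : {poly int}.
have eh : ev theta h = ev theta (Gam ^+ q.-1) / p%:R.
  rewrite ec rmorph_sum /=; apply: eq_bigr => i _.
  rewrite rmorphM rmorphXn /= evX evE map_polyC hornerC mulrC.
  by rewrite -[theta ^+ i in RHS]mulr1 mulrzAr.
have : ev theta (Gam ^+ q.-1) = ev theta (p%:R * h).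
  by rewrite rmorphM rmorph_nat /= eh mulrC divfK.
by move/(ev_eq Fm Fi Froot) => [K]; apply: Gam_not_dvd.
Qed.
End NotMonogenic.

Lemma not_monogenic a b p N : prime p -> coprime b p -> (0 < N)%N -> (p %| N)%N ->
  one_root a b p -> ~~ (4 %| a)%N -> ((p %| a ^ 2 + 4 * b)%N -> p != 3) ->
  wall_sun_sun_prime a b p -> ~ monogenic (quadf a b \Po 'X^N).
Proof.
move=> pp co N0 pN h1 a4 hp3 wss [_ Fi basis]; have p1 := prime_gt1 pp.
have ct := wall_sun_sun_coprime pp wss h1 a4 hp3.
have [_ _ epi] := wss.
have p21 : (1 < p ^ 2)%N by rewrite (@ltn_exp2r 1 p 2).
have co2 : coprime b (p ^ 2) by rewrite coprimeXr.
have [per _] := lucas_piP a p21 co2; rewrite epi in per.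
set t := lucas_pi a b p in ct per; have [t0 _] := per.
have cX := (lucas_period_cong a co2 t0).2 per.
have eN : N = (N`_p^' * p ^ logn p N)%N by rewrite -p_part mulnC partnC.
set m := (N`_p^')%N in eN; set k := logn p N in eN.
have k0 : (0 < k)%N by rewrite logn_gt0 mem_primes pp N0.
have q1 : (1 < p ^ k)%N by rewrite -(exp1n k) ltn_exp2r.
have m0 : (0 < m)%N by rewrite part_gt0.
have pm : ~~ (p %| m)%N.
  by rewrite -prime_coprime // (pnat_coprime (pnat_id pp)) // part_pnat.
(* The period t is prime to p, so p^k has an inverse e modulo t, which makes X^(p^k e) = X modulo
   (p^2, f). *)
have [e [j ej]] : exists e j, (p ^ k * e = 1 + t * j)%N.
  have cqt : coprime (p ^ k) t by rewrite coprimeXl.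
  have /(coprimeP _ (ltnW q1))[[e j] /= ej] := cqt.
  by exists e, j; rewrite mulnC [(t * j)%N]mulnC -ej subnK // ltnW // -subn_gt0 ej.
have he : cong (p ^ 2)%:R (quadf a b) ('X ^+ (p ^ k * e)) 'X.
  rewrite ej exprD exprM expr1 -[X in cong _ _ _ X]mulr1; apply: congM; first exact: cong_refl.
  by have := congX j cX; rewrite expr1n.
have [L _ [theta Ft _]] := irredp_FAdjoin Fi.
rewrite map_poly_in_alg_intr in Ft; have B := basis L theta Ft.
rewrite eN in Fi Ft B.
by apply: (@not_basis a b p (p ^ k) m e L theta) B => //; exists k.
Qed.

(* The equivalence for N = s^n *)
Local Close Scope ring_scope.

Theorem theorem1p2 (a b s n : nat)
  (ha : 0 < a) (hb : 0 < b) (ha4 : a <> 0 %[mod 4])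
  (hbsf : squarefree b) (hDsf : squarefree (calD a b))
  (hs : 1 <= s) (hbs : gcdn b s = 1)
  (hdelta : forall p, prime p -> 3 <= p -> p %| s ->
              legendre (calD a b) p <> 1%R)
  (hdelta3 : 3 %| s -> legendre (calD a b) 3 = (-1)%R)
  (hn : 1 <= n) :
  monogenic (calF a b s n) <->
  (forall p, prime p -> p %| s -> ~ wall_sun_sun_prime a b p).
Proof.
have N0 : (0 < s ^ n)%N by rewrite expn_gt0 hs.
have cop p : (p %| s)%N -> coprime b p.
  by move=> ps; apply: coprime_dvdr ps _; apply/eqP.
have h1 p : prime p -> (p %| s)%N -> one_root a b p.
  (* At p = 2 the Legendre condition is silent; coprimality of b and s makes b odd instead. *)
  move=> pp ps; have [p2|p2] := eqVneq p 2%N.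
    by subst p; apply: one_root_2; rewrite -coprimen2 cop.
  apply: one_root_odd => //; apply: hdelta => //.
  by rewrite ltn_neqAle eq_sym p2 prime_gt1.
split=> [mono p pp ps wss|nwss].
  apply: (not_monogenic pp (cop p ps) N0 _ (h1 p pp ps) _ _ wss mono).
  - by rewrite Euclid_dvdX // ps hn.
  - by apply/negP => /eqP a4; apply: ha4; rewrite a4 mod0n.
  (* The value -1 of the symbol at 3 excludes 3 | D, hence 3 | a^2 + 4 b. *)
  move=> pD; apply/eqP => p3; subst p; move: (hdelta3 ps) pD; rewrite /legendre.
  case: ifP => // nD _; have [ao|ao] := boolP (odd a).
    by move: nD; rewrite /calD ao => ->.
  by rewrite calD_even // Euclid_dvdM // nD.
have hN p : prime p -> (p %| s ^ n)%N ->
    [/\ coprime b p, one_root a b p & ~ wall_sun_sun_prime a b p].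
  move=> pp; rewrite Euclid_dvdX // => /andP[ps _].
  by split; [apply: cop | apply: h1 | apply: nwss].
have Fm := quadf_compX_monic a b N0.
have Fi := quadf_compX_irreducible ha hb ha4 hbsf hDsf N0 hN.
split=> // L theta root; apply: dedekind_basis => // p g pp gi.
by apply: not_insq_quadf => //; apply: hN.
Qed.
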